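(* Let $n\ge2$, let $\Omega_0\subset\mathbb R^n$ be a bounded convex domain, $x_0\in\Omega_0$, $\Omega=\Omega_0\setminus\{x_0\}$, and let $u$ be the $\infty$-harmonic potential of $\Omega$ (i.e. $u=0$ on $\partial\Omega_0$, $u(x_0)=1$). The following are equivalent: (i) $\Omega_0=B(x_0,r)$ for some $r>0$; (ii) $u\in C^2(\Omega)$; (iii) $u$ is concave on $\Omega_0$.
   Context: The $\infty$-harmonic potential of $\Omega=\Omega_0\setminus\{x_0\}$ is the unique $u\in C^0(\overline{\Omega_0})$ which is a viscosity solution (Crandall–Ishii–Lions sense) of $\Delta_\infty u:=\langle D^2u\,Du,Du\rangle=0$ in $\Omega$ with $u=0$ on $\partial\Omega_0$ and $u(x_0)=1$. *)

(* Defs.v *)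
From HB Require Import structures.
From mathcomp Require Import all_boot all_order all_algebra.
From mathcomp Require Import all_classical all_reals all_analysis.
Set Implicit Arguments. Unset Strict Implicit. Unset Printing Implicit Defensive.
Import Order.TTheory GRing.Theory Num.Theory.
Import numFieldNormedType.Exports.
Local Open Scope classical_set_scope.
Local Open Scope ring_scope.

Section Defs.
Variables (R : realType) (n : nat).
Local Notation V := 'rV[R]_n.

Definition evec (i : 'I_n) : V := \row_(j < n) (i == j)%:R.

Definition partial (i : 'I_n) (f : V -> R) : V -> R :=
  fun x => 'D_(evec i) f x.

Definition enorm (x : V) : R := Num.sqrt (\sum_(i < n) x ord0 i ^+ 2).
Definition eball (c : V) (r : R) : set V := [set y | enorm (y - c) < r].

Definition C2_on (U : set V) (f : V -> R) : Prop :=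
  {within U, continuous f} /\
  (forall i, (forall x, U x -> derivable f x (evec i)) /\
             {within U, continuous (partial i f)}) /\
  (forall i j, (forall x, U x -> derivable (partial i f) x (evec j)) /\
               {within U, continuous (partial j (partial i f))}).

Definition inf_laplacian (f : V -> R) (x : V) : R :=
  \sum_(i < n) \sum_(j < n)
     partial j (partial i f) x * partial i f x * partial j f x.

Definition visc_subsol (U : set V) (u : V -> R) : Prop :=
  forall x phi, U x ->
    (exists W : set V, [/\ open W, W x & C2_on W phi]) ->
    (\forall y \near x, u y - phi y <= u x - phi x) ->
    0 <= inf_laplacian phi x.

Definition visc_supersol (U : set V) (u : V -> R) : Prop :=
  forall x phi, U x ->
    (exists W : set V, [/\ open W, W x & C2_on W phi]) ->
    (\forall y \near x, u x - phi x <= u y - phi y) ->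
    inf_laplacian phi x <= 0.

Definition visc_sol (U : set V) (u : V -> R) : Prop :=
  {within U, continuous u} /\ visc_subsol U u /\ visc_supersol U u.

Definition convex_set (A : set V) : Prop :=
  forall x y (t : R), A x -> A y -> 0 <= t <= 1 -> A ((1 - t) *: x + t *: y).

Definition concave_on (A : set V) (u : V -> R) : Prop :=
  forall x y (t : R), A x -> A y -> 0 <= t <= 1 ->
    (1 - t) * u x + t * u y <= u ((1 - t) *: x + t *: y).

Definition bounded_convex_domain (O : set V) : Prop :=
  [/\ open O, connected O, bounded_set O & convex_set O].

Definition inf_harmonic_potential (O : set V) (x0 : V) (u : V -> R) : Prop :=
  [/\ {within closure O, continuous u},
      visc_sol (O `\ x0) u,
      (forall x, (closure O `\` O) x -> u x = 0) &
      u x0 = 1].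

End Defs.

(* Main.v *)
Require Import Defs.
From HB Require Import structures.
From mathcomp Require Import all_boot all_order all_algebra.
From mathcomp Require Import all_classical all_reals all_analysis.
From mathcomp Require Import ring lra.
Import Order.TTheory GRing.Theory Num.Theory.
Import numFieldNormedType.Exports.
Local Open Scope classical_set_scope.
Local Open Scope ring_scope.

Set Implicit Arguments.
Unset Strict Implicit.
Unset Printing Implicit Defensive.

(* Let [d] be the distance from [x0] to the boundary and [k = 1/d].  Comparison with cones gives
   [u >= 1 - k|x - x0|], that [u] is [k]-Lipschitz, and [u = 1 - k|x - x0|] on the segment from
   [x0] to a nearest boundary point.  For the slope [q x = (1 - u x)/|x - x0|], the cone with
   vertex [x] gives [q y >= q x (1 - 2 (1 - cos w))] when [y] is at most half as far from [x0]
   as [x] and [w] is the angle at [x0]; splitting an angle into many small ones makes the loss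
   negligible, so [q -> k] uniformly at [x0].  Hence [q x >= k] as soon as [q] does not increase
   when [x] moves towards [x0] along a ray.

   If [u] is concave, it has this property on all of the domain, and [u >= 0] confines the domain
   to the ball of radius [d].

   If [u] is C^2, then [|Du|^2] is constant along the gradient flow.  Flow lines are never
   constructed: invariance is used through the critical points of auxiliary functions over
   regions [t <= u <= t'] (a critical point of [F(|Du|^2) + e u] satisfies [e |Du|^2 = 0]).  A
   barrier argument shows that the zero set of [Du] is open, hence empty.  Where [|Du|] is
   minimal the flow is straight, so the Legendre transform [Du.(x - x0) - u] is constant along
   it and equal to its value [-1] at the pole; this forces [q <= min |Du|] near [x0], hence
   [min |Du| = k].  Since [|Du| <= k], every point is minimal, [Du.(x - x0) - u = -1] everywhere,
   [q] is constant along rays, and [u = 1 - k|x - x0|] in the ball of radius [d].  A point of the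
   domain on the sphere of radius [d] would be an interior minimum of [u], contradicting
   [Du <> 0]. *)

Section DotProduct.
Context {R : realType} {n : nat}.
Implicit Types (x y z : 'rV[R]_n) (a : R) (A : 'M[R]_n).

Definition dot x y : R := (x *m y^T) ord0 ord0.

Lemma dotE x y : dot x y = \sum_(i < n) x ord0 i * y ord0 i.
Proof. by rewrite /dot mxE; apply: eq_bigr => i _; rewrite mxE. Qed.

Lemma dotC x y : dot x y = dot y x.
Proof. by rewrite !dotE; apply: eq_bigr => i _; rewrite mulrC. Qed.

Lemma dotDl x y z : dot (x + y) z = dot x z + dot y z.
Proof. by rewrite /dot mulmxDl mxE. Qed.

Lemma dotDr x y z : dot x (y + z) = dot x y + dot x z.
Proof. by rewrite /dot linearD mulmxDr mxE. Qed.

Lemma dotZl a x y : dot (a *: x) y = a * dot x y.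
Proof. by rewrite /dot -scalemxAl mxE. Qed.

Lemma dotZr a x y : dot x (a *: y) = a * dot x y.
Proof. by rewrite /dot linearZ -scalemxAr mxE. Qed.

Lemma dotNl x y : dot (- x) y = - dot x y.
Proof. by rewrite /dot mulNmx mxE. Qed.

Lemma dotNr x y : dot x (- y) = - dot x y.
Proof. by rewrite /dot linearN mulmxN mxE. Qed.

Lemma dotBl x y z : dot (x - y) z = dot x z - dot y z.
Proof. by rewrite dotDl dotNl. Qed.

Lemma dotBr x y z : dot x (y - z) = dot x y - dot x z.
Proof. by rewrite dotDr dotNr. Qed.

Lemma dot0l y : dot 0 y = 0.
Proof. by rewrite /dot mul0mx mxE. Qed.

Lemma dot0r x : dot x 0 = 0.
Proof. by rewrite dotC dot0l. Qed.

Definition dot_linE := (dotBl, dotBr, dotDl, dotDr, dotNl, dotNr, dotZl, dotZr).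

Lemma dot_mulmx x y A : dot (x *m A) y = dot x (y *m A^T).
Proof. by rewrite /dot trmx_mul trmxK mulmxA. Qed.

Lemma dot_ge0 x : 0 <= dot x x.
Proof. by rewrite dotE sumr_ge0// => i _; rewrite -expr2 sqr_ge0. Qed.

Lemma dot_evec x i : dot x (evec R i) = x ord0 i.
Proof.
rewrite dotE (bigD1 i)//= big1 ?addr0 => [|j ji]; rewrite mxE.
  by rewrite eqxx mulr1.
by rewrite eq_sym (negbTE ji) mulr0.
Qed.

End DotProduct.

Lemma enorm_ge0 (R : realType) (n : nat) (x : 'rV[R]_n) : 0 <= enorm x.
Proof. exact: sqrtr_ge0. Qed.

#[local] Hint Extern 0 (is_true (0 <= enorm _)) => solve[exact: enorm_ge0] : core.

Section EuclideanNorm.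
Context {R : realType} {n : nat}.
Implicit Types (x y z : 'rV[R]_n) (a r : R) (A : set 'rV[R]_n).

Lemma enormE x : enorm x = Num.sqrt (dot x x).
Proof. by rewrite /enorm dotE; congr Num.sqrt; apply: eq_bigr => i _; rewrite expr2. Qed.

Lemma sqr_enorm x : enorm x ^+ 2 = dot x x.
Proof. by rewrite enormE sqr_sqrtr ?dot_ge0. Qed.

Lemma coord_le_enorm x i : `|x ord0 i| <= enorm x.
Proof.
rewrite -sqrtr_sqr; apply: ler_wsqrtr.
by rewrite (bigD1 i)//= lerDl sumr_ge0// => j _; rewrite sqr_ge0.
Qed.

Lemma enorm0 : enorm (0 : 'rV[R]_n) = 0.
Proof. by rewrite enormE dot0l sqrtr0. Qed.

Lemma enorm_eq0 x : (enorm x == 0) = (x == 0).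
Proof.
apply/eqP/eqP => [x0|->]; last exact: enorm0.
by apply/rowP => i; apply/eqP; rewrite mxE -normr_le0 -x0 coord_le_enorm.
Qed.

Lemma enorm_gt0 x : (0 < enorm x) = (x != 0).
Proof. by rewrite lt_def enorm_ge0 andbT enorm_eq0. Qed.

Lemma enorm_sub_gt0 x y : x <> y -> 0 < enorm (x - y).
Proof. by move=> xy; rewrite enorm_gt0 subr_eq0; apply/eqP. Qed.

Lemma enormZ a x : enorm (a *: x) = `|a| * enorm x.
Proof. by rewrite !enormE dotZl dotZr mulrA -expr2 sqrtrM ?sqr_ge0// sqrtr_sqr. Qed.

Lemma enormN x : enorm (- x) = enorm x.
Proof. by rewrite -scaleN1r enormZ normrN normr1 mul1r. Qed.

Lemma enormBC x y : enorm (x - y) = enorm (y - x).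
Proof. by rewrite -enormN opprB. Qed.

Lemma enorm_normalize x : x != 0 -> enorm ((enorm x)^-1 *: x) = 1.
Proof. by move=> x0; rewrite enormZ ger0_norm ?invr_ge0// mulVf// enorm_eq0. Qed.

Lemma enorm_evec i : enorm (@evec R n i) = 1.
Proof. by rewrite enormE dot_evec mxE eqxx sqrtr1. Qed.

Lemma enorm_ray x (t : R) y : 0 <= t -> enorm (x + t *: y - x) = t * enorm y.
Proof. by move=> t0; rewrite addrAC subrr add0r enormZ ger0_norm. Qed.

Lemma dot_le_enorm x y : dot x y <= enorm x * enorm y.
Proof.
have [->|x0] := eqVneq x 0; first by rewrite enorm0 mul0r dot0l.
have [->|y0] := eqVneq y 0; first by rewrite enorm0 mulr0 dot0r.
have := dot_ge0 (enorm y *: x - enorm x *: y).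
rewrite !dot_linE -!sqr_enorm (dotC y x).
move: x0 y0; rewrite -!enorm_gt0 => x0 y0.
have xy0 : 0 < 2 * (enorm x * enorm y) by rewrite !mulr_gt0.
move=> h; rewrite -subr_ge0 -(pmulr_rge0 _ xy0); apply: le_trans h _.
by rewrite le_eqVlt; apply/orP; left; apply/eqP; ring.
Qed.

Lemma norm_dot_le_enorm x y : `|dot x y| <= enorm x * enorm y.
Proof. by rewrite ler_norml lerNl -dotNl -{1}(enormN x) !dot_le_enorm. Qed.

Lemma ler_enormD x y : enorm (x + y) <= enorm x + enorm y.
Proof.
rewrite -(@ler_pXn2r _ 2%N) ?nnegrE ?addr_ge0//.
rewrite sqr_enorm !dot_linE sqrrD !sqr_enorm (dotC y x).
by have := dot_le_enorm x y; lra.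
Qed.

Lemma ler_enorm_distD y x z : enorm (x - z) <= enorm (x - y) + enorm (y - z).
Proof. by have := ler_enormD (x - y) (y - z); rewrite addrA subrK. Qed.

Lemma mx_norm_le_enorm x : `|x| <= enorm x.
Proof.
rewrite [leLHS]/Num.Def.normr /= mx_normrE; apply/bigmax_leP; split => //.
by move=> [i j] _ /=; rewrite ord1 coord_le_enorm.
Qed.

Lemma coord_le_mx_norm x i : `|x ord0 i| <= `|x|.
Proof.
rewrite [leRHS]/Num.Def.normr /= mx_normrE.
by apply/bigmax_geP; right; exists (ord0, i).
Qed.

Lemma enorm_le_mx_norm x : enorm x <= n.+1%:R * `|x|.
Proof.
rewrite -(@ler_pXn2r _ 2%N) ?nnegrE ?mulr_ge0// sqr_enorm exprMn dotE.
apply: (@le_trans _ _ (\sum_(i < n) `|x| ^+ 2)).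
  apply: ler_sum => i _; rewrite -expr2 -real_normK ?num_real//.
  by rewrite ler_pXn2r ?nnegrE// coord_le_mx_norm.
rewrite sumr_const card_ord -[leLHS]mulr_natl ler_wpM2r ?sqr_ge0//.
by rewrite -natrX ler_nat (leq_trans (leqnSn n))// -{1}(expn1 n.+1) leq_pexp2l.
Qed.

Lemma nbhs_eballP x (A : set 'rV[R]_n) :
  nbhs x A <-> exists2 r : R, 0 < r & eball x r `<=` A.
Proof.
split=> [/nbhs_normP[r /= r0 rA]|[r r0 rA]].
  exists r => // y; rewrite /eball/= => xy; apply: rA => /=.
  by rewrite distrC (le_lt_trans (mx_norm_le_enorm _)).
apply/nbhs_ballP; exists (r / n.+1%:R) => [|y]; first by rewrite /= divr_gt0.
rewrite -ball_normE /= distrC ltr_pdivlMr// mulrC => xy; apply: rA.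
exact: le_lt_trans (enorm_le_mx_norm _) xy.
Qed.

Lemma enormB_continuous z : continuous (fun x => enorm (x - z)).
Proof.
move=> x; apply/(@cvgrPdist_lt _ R^o _ (nbhs x)) => e e0.
apply/nbhs_eballP; exists e => // y; rewrite /eball/= => yx.
have := ler_enorm_distD y x z; have := ler_enorm_distD x y z.
by rewrite (enormBC x y) => h1 h2; rewrite ltr_norml; apply/andP; split; lra.
Qed.

Lemma open_eball z r : open (eball z r).
Proof.
rewrite (_ : eball z r = (fun x => enorm (x - z)) @^-1` [set t | t < r])//.
by apply: open_comp; [move=> ? _; exact: enormB_continuous|exact: open_lt].
Qed.

Lemma open_shell z (a b : R) : open [set x : 'rV[R]_n | a < enorm (x - z) < b].
Proof.
rewrite (_ : [set x | _] = (fun x => enorm (x - z)) @^-1` `]a, b[%classic).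
  by apply: open_comp; [move=> ? _; exact: enormB_continuous|exact: itv_open].
by apply/funext => x; rewrite /= in_itv.
Qed.

Lemma bounded_enormP A z :
  bounded_set A <-> exists M : R, forall x, A x -> enorm (x - z) <= M.
Proof.
split=> [[M [_ /(_ (M + 1))]]|[M AM]].
  rewrite ltrDl ltr01 => /(_ isT) AM.
  exists (n.+1%:R * (M + 1 + `|z|)) => x /AM /= xM.
  apply: le_trans (enorm_le_mx_norm _) _.
  by rewrite ler_wpM2l// (le_trans (ler_normB _ _))// lerD2r.
exists (M + enorm z); split; first exact: num_real.
move=> N /ltW MN x /AM xM; apply: le_trans (mx_norm_le_enorm _) (le_trans _ MN).
by have := ler_enormD (x - z) z; rewrite subrK; lra.
Qed.

Lemma closure_enorm_le A z (M : R) :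
  (forall x, A x -> enorm (x - z) <= M) -> forall x, closure A x -> enorm (x - z) <= M.
Proof.
have cM : closed [set x : 'rV[R]_n | enorm (x - z) <= M].
  rewrite (_ : [set x | _] = (fun x => enorm (x - z)) @^-1` [set t | t <= M])//.
  by apply: preimage_closed; [move=> ? _; exact: enormB_continuous|exact: closed_le].
by move=> AM x cx; apply: cM; move: x cx; exact: closureS.
Qed.

Lemma compact_closure_bounded A : bounded_set A -> compact (closure A).
Proof.
move=> /(bounded_enormP _ 0)[M AM]; apply: bounded_closed_compact; last exact: closed_closure.
by apply/(bounded_enormP _ 0); exists M; exact: closure_enorm_le.
Qed.

Lemma compact_shell z (a b : R) : compact [set x : 'rV[R]_n | a <= enorm (x - z) <= b].
Proof.
apply: bounded_closed_compact.
  by apply/(bounded_enormP _ z); exists b => x /andP[].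
rewrite (_ : [set x | _] = (fun x => enorm (x - z)) @^-1` `[a, b]%classic).
  by apply: preimage_closed; [move=> ? _; exact: enormB_continuous|exact: itv_closed].
by apply/funext => x; rewrite /= in_itv.
Qed.

Lemma open_neq_row z : open [set x : 'rV[R]_n | x <> z].
Proof.
rewrite (_ : [set x | _] = ~` [set z])//; apply: closed_openC.
by apply: accessible_closed_set1; apply: hausdorff_accessible; exact: norm_hausdorff.
Qed.

End EuclideanNorm.

Section UnitVectors.
Context {R : realType} {n : nat}.
Implicit Types a b e : 'rV[R]_n.

Lemma dot_unit_le1 a b : enorm a = 1 -> enorm b = 1 -> dot a b <= 1.
Proof. by move=> a1 b1; have := dot_le_enorm a b; rewrite a1 b1 mulr1. Qed.

Lemma exists_dot_eq0 e : (2 <= n)%N -> exists2 w, w != 0 & dot w e = 0.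
Proof.
case: n e => [|[|m]] // e _.
have [e00|e00] := eqVneq (e ord0 ord0) 0.
  exists (evec R ord0); last by rewrite dotC dot_evec.
  by rewrite -enorm_gt0 enorm_evec.
exists (e ord0 ord0 *: evec R (inord 1) - e ord0 (inord 1) *: evec R ord0).
  apply/eqP => /rowP/(_ (inord 1)); rewrite !mxE eqxx -val_eqE/= inordK// mulr0 subr0 mulr1.
  exact/eqP.
by rewrite !dot_linE !(dotC (evec _ _)) !dot_evec mulrC subrr.
Qed.

Lemma exists_unit_perp e b : (2 <= n)%N ->
  exists z, [/\ enorm z = 1, dot z e = 0 & 0 <= dot z b].
Proof.
move=> /(exists_dot_eq0 e)[w w0 we]; pose z := (enorm w)^-1 *: w.
have z1 : enorm z = 1 by exact: enorm_normalize.
have ze : dot z e = 0 by rewrite dotZl we mulr0.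
have [zb|/ltW zb] := leP 0 (dot z b); first by exists z.
by exists (- z); rewrite enormN z1 !dotNl ze oppr0 oppr_ge0.
Qed.

(* The normalized midpoint halves the angle: [1 - cos (w / 2) <= 3/10 (1 - cos w)] for
   [0 <= w <= pi / 2]. *)
Lemma exists_unit_bisector a b : enorm a = 1 -> enorm b = 1 -> 0 <= dot a b ->
  exists m, [/\ enorm m = 1, 0 <= dot a m, dot m b = dot a m &
    1 - dot a m <= 3 / 10 * (1 - dot a b)].
Proof.
move=> a1 b1 ab; pose N := enorm (a + b).
have aa : dot a a = 1 by rewrite -sqr_enorm a1 expr1n.
have bb : dot b b = 1 by rewrite -sqr_enorm b1 expr1n.
have N2 : N ^+ 2 = 2 + 2 * dot a b.
  by rewrite sqr_enorm !dot_linE aa bb (dotC b a); ring.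
have N0 : 0 < N.
  by rewrite lt_neqAle enorm_ge0 andbT; apply/eqP => E; move: N2; rewrite -E expr0n/=; lra.
have half c : 1 + dot a b = c -> N^-1 * c = N / 2.
  move=> <-; have -> : 1 + dot a b = N ^+ 2 / 2 by rewrite N2; lra.
  by rewrite expr2 -mulrA mulKf// gt_eqF.
exists (N^-1 *: (a + b)); rewrite !dot_linE aa bb.
rewrite enorm_normalize -?enorm_gt0// (half _ erefl) half; last by rewrite addrC.
by split => //; [lra|have := dot_unit_le1 a1 b1; nra].
Qed.

End UnitVectors.

Lemma continuous_sum_ord (R : realType) (T : topologicalType) (m : nat) (F : 'I_m -> T -> R)
    (x : T) : (forall i, {for x, continuous (F i)}) ->
  {for x, continuous (fun y => \sum_(i < m) F i y)}.
Proof.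
move=> cF; rewrite -fct_sumE; apply: (big_ind (fun f : T -> R => {for x, continuous f})) => //.
  exact: cst_continuous.
by move=> f g cf cg; exact: (continuousD cf cg).
Qed.

Section Gradient.
Context {R : realType} {n : nat}.
Implicit Types (f g : 'rV[R]_n -> R) (x v w z : 'rV[R]_n).

Definition has_grad f x v := is_diff x f (dot v).

Definition grad f x : 'rV[R]_n := \row_i partial i f x.

HB.instance Definition _ v := GRing.isLinear.Build R 'rV[R]_n R *%R (dot v)
  (fun a x y => etrans (dotDr v (a *: x) y) (congr1 (+%R^~ (dot v y)) (dotZr a v x))).

Lemma dot_continuous v : continuous (dot v).
Proof.
apply/linear_bounded_continuous/bounded_funP => r.
exists (enorm v * (n.+1%:R * r)) => x xr; apply: le_trans (norm_dot_le_enorm _ _) _.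
by rewrite ler_wpM2l ?enorm_ge0// (le_trans (enorm_le_mx_norm _))// ler_wpM2l.
Qed.

Lemma has_gradP f x v : has_grad f x v <->
  forall e : R, 0 < e -> \forall w \near (0 : 'rV[R]_n),
    `|f (x + w) - f x - dot v w| <= e * enorm w.
Proof.
have errE w : (f \o shift x - (cst (f x) + dot v)) w = f (x + w) - f x - dot v w.
  by rewrite !fctE/= opprD addrA (addrC w).
split=> [[/diff_locally df dE] e e0|fo].
  have /eqaddoP/(_ e e0) := df; apply: filterS => w.
  by rewrite dE errE => /le_trans; apply; rewrite ler_wpM2l ?(ltW e0)// mx_norm_le_enorm.
have df : f \o shift x = cst (f x) + dot v +o_ (0 : 'rV[R]_n) id.
  apply/eqaddoP => e e0; have e'0 : 0 < e / n.+1%:R by rewrite divr_gt0.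
  apply: filterS (fo _ e'0) => w; rewrite -mulrA errE => /le_trans; apply.
  by rewrite ler_wpM2l ?(ltW e0)// ler_pdivrMl// enorm_le_mx_norm.
have dE := diff_unique (@dot_continuous v) df.
by split=> //; apply/diff_locallyP; rewrite dE; split => //; exact: dot_continuous.
Qed.

Lemma has_grad_is_derive f x v w : has_grad f x v -> is_derive x w f (dot v w).
Proof.
move=> [df dE]; split; first exact: diff_derivable.
by rewrite deriveE// dE.
Qed.

Lemma grad_val f x v : has_grad f x v -> grad f x = v.
Proof.
move=> fv; apply/rowP => i; rewrite mxE -dot_evec.
exact: (@derive_val _ _ _ _ _ _ _ (has_grad_is_derive (evec R i) fv)).
Qed.

Lemma has_grad_continuous f x v : has_grad f x v -> {for x, continuous f}.
Proof. by move=> [df _]; exact: differentiable_continuous. Qed.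

Lemma has_grad_dotr v x : has_grad (dot v) x v.
Proof.
split; last exact: diff_lin (@dot_continuous v).
exact: linear_differentiable (@dot_continuous v).
Qed.

Lemma has_grad_cst (c : R) x : has_grad (fun=> c) x 0.
Proof. by apply: is_diff_eq; apply/funext => w; rewrite dot0l. Qed.

Lemma has_gradD f g x v w : has_grad f x v -> has_grad g x w ->
  has_grad (fun y => f y + g y) x (v + w).
Proof.
by move=> fv gw; apply: is_diff_eq (is_diffD fv gw) _; apply/funext => y; rewrite dotDl.
Qed.

Lemma has_gradN f x v : has_grad f x v -> has_grad (fun y => - f y) x (- v).
Proof.
by move=> fv; apply: is_diff_eq (is_diffN fv) _; apply/funext => y; rewrite dotNl.
Qed.

Lemma has_gradB f g x v w : has_grad f x v -> has_grad g x w ->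
  has_grad (fun y => f y - g y) x (v - w).
Proof. by move=> fv gw; exact: has_gradD fv (has_gradN gw). Qed.

Lemma has_gradM f g x v w : has_grad f x v -> has_grad g x w ->
  has_grad (fun y => f y * g y) x (f x *: w + g x *: v).
Proof.
move=> fv gw; apply: is_diff_eq (is_diffM fv gw) _.
by apply/funext => y; rewrite dotDl !dotZl.
Qed.

Lemma has_gradZ (c : R) f x v : has_grad f x v -> has_grad (fun y => c * f y) x (c *: v).
Proof. by move=> fv; have := has_gradM (has_grad_cst c x) fv; rewrite scaler0 addr0. Qed.

Lemma has_grad_sqr f x v : has_grad f x v ->
  has_grad (fun y => f y ^+ 2) x ((2 * f x) *: v).
Proof.
by move=> fv; rewrite mulr_natl mulr2n scalerDl; exact: (has_gradM fv fv).
Qed.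

Lemma has_grad_sum (F : 'I_n -> 'rV[R]_n -> R) x (v : 'I_n -> 'rV[R]_n) :
  (forall i, has_grad (F i) x (v i)) ->
  has_grad (fun y => \sum_(i < n) F i y) x (\sum_(i < n) v i).
Proof.
move=> Fv; rewrite -fct_sumE; apply: (big_ind2 (fun f v => has_grad f x v)) => //.
  exact: has_grad_cst.
by move=> f v1 g v2; exact: has_gradD.
Qed.

Lemma has_grad_comp (h : R -> R) f x v (dh : R) :
  has_grad f x v -> is_derive (f x) (1 : R) h dh -> has_grad (h \o f) x (dh *: v).
Proof.
move=> fv [/[dup] dh1 /derivable1_diffP dhx dhE].
apply: is_diff_eq (is_diff_comp fv (differentiableP dhx)) _.
by apply/funext => y; rewrite deriv1E//= derive1E dhE dotZl mulrC.
Qed.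

Lemma has_grad_near_eq f g x v :
  (\forall y \near x, f y = g y) -> has_grad f x v -> has_grad g x v.
Proof.
move=> fg /has_gradP fv; apply/has_gradP => e e0.
have fg0 : \forall w \near (0 : 'rV[R]_n), f (x + w) = g (x + w).
  have /nbhs_eballP[r r0 fg_r] := fg; apply/nbhs_eballP; exists r => // w.
  by rewrite /eball/= subr0 => wr; apply: fg_r; rewrite /eball/= addrAC subrr add0r.
by apply: filterS2 fg0 (fv e e0) => w <-; rewrite (nbhs_singleton fg).
Qed.

Lemma has_grad_growth_le f x v (k : R) : 0 <= k ->
  (\forall y \near x, f y <= f x + k * enorm (y - x)) -> has_grad f x v -> enorm v <= k.
Proof.
move=> k0 growth /has_gradP fv; have [->|] := eqVneq v 0; first by rewrite enorm0.
rewrite -enorm_gt0 => v0; apply/ler_addgt0Pr => e e0.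
have /nbhs_eballP[r1 r10 growth_r1] := growth; have /nbhs_eballP[r2 r20 fv_r2] := fv e e0.
pose t := Num.min r1 r2 / (2 * enorm v).
have t0 : 0 < t by rewrite divr_gt0 ?mulr_gt0// lt_min r10.
have tvE : enorm (t *: v) = t * enorm v by rewrite enormZ gtr0_norm.
have : enorm (t *: v) < Num.min r1 r2.
  by rewrite tvE /t invfM mulrA divfK ?gt_eqF// ltr_pdivrMr// ltr_pMr ?lt_min ?r10// ltr1n.
rewrite lt_min => /andP[tv1 tv2].
have := growth_r1 (x + t *: v); rewrite /eball/= addrAC subrr add0r => /(_ tv1).
have := fv_r2 (t *: v); rewrite /eball/= subr0 => /(_ tv2).
rewrite tvE ler_norml dotZr -sqr_enorm => /andP[low _] high.
by rewrite -(ler_pM2r (mulr_gt0 t0 v0)) mulrDl mulrCA -expr2; lra.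
Qed.

Lemma has_grad_local_max f x v :
  (\forall y \near x, f y <= f x) -> has_grad f x v -> v = 0.
Proof.
move=> xmax fv; apply/eqP; rewrite -enorm_eq0 eq_le enorm_ge0 andbT.
by apply: has_grad_growth_le fv => //; apply: filterS xmax => y; rewrite mul0r addr0.
Qed.

Lemma has_grad_local_min f x v :
  (\forall y \near x, f x <= f y) -> has_grad f x v -> v = 0.
Proof.
move=> xmin /has_gradN fv; apply: oppr_inj; rewrite oppr0.
by apply: has_grad_local_max fv; apply: filterS xmin => y; rewrite lerN2.
Qed.

Lemma shift_line_continuous x v : continuous (fun s : R => x + s *: v).
Proof.
by move=> t; apply: cvgD; [exact: cvg_cst|apply: cvgZr_tmp; exact: cvg_id].
Qed.

Lemma is_derive_line f x v (t d : R) :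
  is_derive (x + t *: v) v f d <-> is_derive t (1 : R) (fun s => f (x + s *: v)) d.
Proof.
suff quotE : (fun h : R => h^-1 *: (((fun s : R => f (x + s *: v)) \o shift t) (h *: (1 : R))
     - f (x + t *: v))) =
    (fun h : R => h^-1 *: ((f \o shift (x + t *: v)) (h *: v) - f (x + t *: v))).
  by split=> -[d1 d2]; split; move: d1 d2; rewrite /derivable /derive quotE.
by apply/funext => h /=; rewrite [h *: 1]mulr1 scalerDl addrCA.
Qed.

Lemma has_grad_line f x v w (t : R) : has_grad f (x + t *: v) w ->
  is_derive t (1 : R) (fun s => f (x + s *: v)) (dot w v).
Proof. by move=> fw; apply/is_derive_line; exact: has_grad_is_derive. Qed.

Lemma MVT_line f x v (c : R) :
  (forall s, 0 <= s <= 1 -> derivable f (x + (s * c) *: v) v) ->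
  exists2 s, 0 < s < 1 & f (x + c *: v) - f x = c * 'D_v f (x + (s * c) *: v).
Proof.
move=> df; pose g (s : R) := f (x + (s * c) *: v).
have dg (s : R) : 0 <= s <= 1 -> is_derive s (1 : R) g ('D_v f (x + (s * c) *: v) * c).
  move=> /df/derivableP/is_derive_line dfs.
  have dc : is_derive s (1 : R) (fun r : R => r * c) c.
    by apply: is_derive_eq; rewrite scaler0 add0r [_ *: _]mulr1.
  exact: (@is_derive1_comp _ (fun r => f (x + r *: v))).
have [||s] := @MVT R g (fun s => 'D_v f (x + (s * c) *: v) * c) 0 1 ltr01.
- by move=> s; rewrite in_itv/= => /andP[s0 s1]; apply: dg; rewrite !ltW.
- apply: derivable_within_continuous => s; rewrite in_itv/= => /dg ?.
  exact: ex_derive.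
rewrite in_itv/= /g mul1r mul0r scale0r addr0 subr0 mulr1 => s01 ->.
by exists s; rewrite // mulrC.
Qed.

End Gradient.

Section VectorFields.
Context {R : realType} {n : nat}.
Implicit Types (x z g : 'rV[R]_n) (V W : 'rV[R]_n -> 'rV[R]_n) (A B : 'M[R]_n).

Definition has_jac V x A := forall i, has_grad (fun y => V y ord0 i) x (row i A).

Lemma has_jac_subr z x : has_jac (fun y => y - z) x 1%:M.
Proof.
move=> i; have -> : row i 1%:M = evec R i - 0.
  by apply/rowP => j; rewrite subr0 !mxE.
rewrite (_ : (fun y => _) = fun y => dot (evec R i) y - z ord0 i).
  exact: has_gradB (has_grad_dotr _ _) (has_grad_cst _ _).
by apply/funext => y; rewrite dotC dot_evec !mxE.
Qed.

Lemma has_jacZ (k : 'rV[R]_n -> R) V x g A : has_grad k x g -> has_jac V x A ->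
  has_jac (fun y => k y *: V y) x (k x *: A + (V x)^T *m g).
Proof.
move=> kg VA i.
have -> : row i (k x *: A + (V x)^T *m g) = k x *: row i A + V x ord0 i *: g.
  by apply/rowP => j; rewrite !mxE big_ord1 !mxE.
rewrite (_ : (fun y => _) = fun y => k y * V y ord0 i); first exact: has_gradM.
by apply/funext => y; rewrite mxE.
Qed.

Lemma has_grad_dot V W x A B : has_jac V x A -> has_jac W x B ->
  has_grad (fun y => dot (V y) (W y)) x (V x *m B + W x *m A).
Proof.
move=> VA WB; rewrite !mulmx_sum_row -big_split/=.
rewrite (_ : (fun y => _) = fun y => \sum_(i < n) V y ord0 i * W y ord0 i).
  by apply: has_grad_sum => i; exact: has_gradM.
by apply/funext => y; rewrite dotE.
Qed.

Lemma has_grad_sqdist z x : has_grad (fun y => dot (y - z) (y - z)) x (2 *: (x - z)).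
Proof.
have := has_grad_dot (has_jac_subr z x) (has_jac_subr z x).
by rewrite mulmx1 scaler_nat mulr2n.
Qed.

Lemma has_grad_enorm z x : x <> z ->
  has_grad (fun y => enorm (y - z)) x ((enorm (x - z))^-1 *: (x - z)).
Proof.
move=> /enorm_sub_gt0 xz; have d0 : 0 < dot (x - z) (x - z) by rewrite -sqr_enorm exprn_gt0.
rewrite (_ : (fun y => enorm (y - z)) = Num.sqrt \o (fun y => dot (y - z) (y - z))).
  have -> : (enorm (x - z))^-1 *: (x - z) =
      (2 * Num.sqrt (dot (x - z) (x - z)))^-1 *: (2 *: (x - z)).
    by rewrite -enormE scalerA invfM mulrAC mulVf ?mul1r.
  exact: has_grad_comp (has_grad_sqdist z x) (is_derive1_sqrt d0).
by apply/funext => y; rewrite enormE.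
Qed.

Lemma has_gradV (f : 'rV[R]_n -> R) x g : f x != 0 -> has_grad f x g ->
  has_grad (fun y => (f y)^-1) x (- (f x ^- 2 *: g)).
Proof.
move=> fx0 [df dE]; split; first exact: differentiableV.
by rewrite diffV// dE; apply/funext => y; rewrite dotNl dotZl -mulNr.
Qed.

End VectorFields.

Section ContinuouslyDifferentiable.
Context {R : realType} {n : nat}.
Implicit Types (f : 'rV[R]_n -> R) (x v w : 'rV[R]_n).

Let trunc (w : 'rV[R]_n) (m : nat) : 'rV[R]_n := \row_i (if (i < m)%N then w ord0 i else 0).

Let truncS w (i : 'I_n) : trunc w i.+1 = trunc w i + w ord0 i *: evec R i.
Proof.
apply/rowP => j; rewrite !mxE ltnS leq_eqVlt eq_sym.
have [<-|ij] := eqVneq i j; first by rewrite eqxx ltnn mulr1 add0r.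
by rewrite mulr0 addr0; move: ij; rewrite -val_eqE => /negbTE ->.
Qed.

Let enorm_trunc_le w (i : 'I_n) (s : R) : 0 <= s <= 1 ->
  enorm (trunc w i + (s * w ord0 i) *: evec R i) <= enorm w.
Proof.
move=> /andP[s0 s1]; rewrite -(@ler_pXn2r _ 2%N) ?nnegrE// !sqr_enorm !dotE.
apply: ler_sum => j _; rewrite -!expr2 !mxE.
have [<-|ij] := eqVneq i j.
  by rewrite ltnn add0r mulr1 exprMn ler_piMl ?sqr_ge0// expr_le1.
by rewrite mulr0 addr0; case: ifP => // _; rewrite expr0n sqr_ge0.
Qed.

Lemma continuous_partial_has_grad f x :
  (\forall y \near x, forall i, derivable f y (evec R i)) ->
  (forall i, {for x, continuous (partial i f)}) -> has_grad f x (grad f x).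
Proof.
move=> df cf; apply/has_gradP => e e0; pose e' := e / n.+1%:R.
have e'0 : 0 < e' by rewrite divr_gt0.
have /nbhs_eballP[r r0 near_r] : \forall y \near x,
    (forall i, derivable f y (evec R i)) /\ forall i, `|partial i f x - partial i f y| <= e'.
  apply: filterI df _; apply: (@filter_forall _ _
    (fun i (y : 'rV[R]_n) => `|partial i f x - partial i f y| <= e') (nbhs x)).
  by move=> i; have /cvgrPdist_le := cf i; apply.
apply/nbhs_eballP; exists r => // w; rewrite /eball/= subr0 => wr.
have in_ball (i : 'I_n) (s : R) : 0 <= s <= 1 ->
    eball x r (x + trunc w i + (s * w ord0 i) *: evec R i).
  move=> s01; rewrite /eball/= -(addrA x) addrAC subrr add0r.
  by apply: le_lt_trans wr; exact: enorm_trunc_le.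
have coord_increment (i : 'I_n) :
    `|f (x + trunc w i.+1) - f (x + trunc w i) - w ord0 i * partial i f x| <= e' * enorm w.
  have [s s01|s /andP[s0 s1]] := @MVT_line _ _ f (x + trunc w i) (evec R i) (w ord0 i).
    by have [df_s _] := near_r _ (in_ball i s s01); exact: df_s.
  have s01 : 0 <= s <= 1 by rewrite !ltW.
  rewrite truncS addrA => ->; rewrite -mulrBr normrM mulrC ler_pM ?coord_le_enorm// distrC.
  by have [_] := near_r _ (in_ball i s s01).
have -> : f (x + w) - f x = \sum_(i < n) (f (x + trunc w i.+1) - f (x + trunc w i)).
  rewrite -(big_mkord xpredT (fun i => f (x + trunc w i.+1) - f (x + trunc w i))).
  rewrite telescope_sumr//; congr (f _ - f _).
    by congr (x + _); apply/rowP => j; rewrite mxE ltn_ord.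
  by rewrite -[LHS]addr0; congr (x + _); apply/rowP => j; rewrite !mxE.
rewrite dotE -sumrB; apply: le_trans (ler_norm_sum _ _ _) _.
apply: (@le_trans _ _ (\sum_(i < n) e' * enorm w)).
  by apply: ler_sum => i _; rewrite mxE mulrC coord_increment.
rewrite sumr_const card_ord -mulr_natr mulrAC ler_wpM2r// /e' mulrAC ler_pdivrMr//.
by rewrite ler_wpM2l ?(ltW e0)// ler_nat.
Qed.

End ContinuouslyDifferentiable.

Section MixedDerivatives.
Context {R : realType} {n : nat}.
Implicit Types (f : 'rV[R]_n -> R) (x v w : 'rV[R]_n).

Definition mixed_difference f x v w (h : R) :=
  f (x + h *: v + h *: w) - f (x + h *: v) - f (x + h *: w) + f x.

Lemma mixed_differenceC f x v w h : mixed_difference f x v w h = mixed_difference f x w v h.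
Proof. by rewrite /mixed_difference (addrAC x); congr (_ + _); exact: addrAC. Qed.

Lemma mixed_differenceE f x v w (h : R) :
  (forall s t : R, 0 <= s <= 1 -> 0 <= t <= 1 ->
    derivable f (x + (s * h) *: v + (t * h) *: w) v /\
    derivable ('D_v f) (x + (s * h) *: v + (t * h) *: w) w) ->
  exists s t : R, [/\ 0 < s < 1, 0 < t < 1 & mixed_difference f x v w h =
    h * (h * 'D_w ('D_v f) (x + (s * h) *: v + (t * h) *: w))].
Proof.
move=> df; have h01 : 0 <= (1 : R) <= 1 by rewrite ler01 lexx.
have h00 : 0 <= (0 : R) <= 1 by rewrite lexx ler01.
pose g y := f (y + h *: w) - f y.
have dg (s : R) : 0 <= s <= 1 -> is_derive (x + (s * h) *: v) v g
    ('D_v f (x + (s * h) *: v + h *: w) - 'D_v f (x + (s * h) *: v)).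
  move=> s01; apply: (@is_deriveB _ _ _ (fun y => f (y + h *: w)) f).
    have [+ _] := df s 1 s01 h01; rewrite mul1r => /derivableP; rewrite addrAC => /is_derive_line.
    move=> dfs; apply/is_derive_line.
    rewrite (_ : (fun r : R => _) = fun r : R => f (x + h *: w + r *: v))//.
    by apply/funext => r; rewrite addrAC.
  by have [+ _] := df s 0 s01 h00; rewrite mul0r scale0r addr0 => /derivableP.
have [s /dg[]//|s s01 gE] := @MVT_line _ _ g x v h.
have s01' : 0 <= s <= 1 by case/andP: s01 => ? ?; rewrite !ltW.
have [t /(df s t s01')[]//|t t01 dgE] := @MVT_line _ _ ('D_v f) (x + (s * h) *: v) w h.
exists s, t; split=> //; rewrite -dgE -(@derive_val _ _ _ _ _ _ _ (dg s s01')) -gE /g.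
by rewrite /mixed_difference opprB addrA addrAC.
Qed.

Lemma mixed_difference_cvg f x v w : (\forall y \near x, derivable f y v) ->
  (\forall y \near x, derivable ('D_v f) y w) -> {for x, continuous ('D_w ('D_v f))} ->
  mixed_difference f x v w h / h ^+ 2 @[h --> 0^'] --> 'D_w ('D_v f) x.
Proof.
move=> df ddf cddf; apply/cvgrPdist_lt => e e0.
have : \forall y \near x, [/\ derivable f y v, derivable ('D_v f) y w &
    `|'D_w ('D_v f) x - 'D_w ('D_v f) y| < e].
  have /cvgrPdist_lt/(_ e e0) := cddf.
  by apply: filterS3 df ddf.
move=> /nbhs_eballP[r r0 near_r]; have vw0 : 0 < enorm v + enorm w + 1.
  by rewrite ltr_wpDl// addr_ge0.
have in_ball (h s t : R) : `|h| < r / (enorm v + enorm w + 1) -> 0 <= s <= 1 -> 0 <= t <= 1 ->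
    eball x r (x + (s * h) *: v + (t * h) *: w).
  rewrite ltr_pdivlMr// => hr /andP[s0 s1] /andP[t0 t1].
  rewrite /eball/= -(addrA x) addrAC subrr add0r.
  apply: le_lt_trans (ler_enormD _ _) _; rewrite !enormZ !normrM (ger0_norm s0) (ger0_norm t0).
  have := mulr_ge0 (normr_ge0 h) (enorm_ge0 v); have := mulr_ge0 (normr_ge0 h) (enorm_ge0 w).
  have := normr_ge0 h; rewrite -!(mulrA _ `|h|); move: hr; rewrite !mulrDr mulr1.
  move: (`|h| * enorm v) (`|h| * enorm w) `|h| => a b c *; nra.
have : \forall h \near (0 : R)^', `|h| < r / (enorm v + enorm w + 1).
  apply: dnbhs0_lt; exact: divr_gt0.
have : \forall h \near (0 : R)^', h != 0 by exact: nbhs_dnbhs_neq.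
apply: filterS2 => h h0 hr.
have [s t s01 t01|s [t [/andP[s0 s1] /andP[t0 t1] ->]]] := @mixed_differenceE f x v w h.
  by have [] := near_r _ (in_ball h s t hr s01 t01).
rewrite mulrA -expr2 mulrAC mulfV ?expf_neq0// mul1r.
have s01 : 0 <= s <= 1 by rewrite !ltW.
have t01 : 0 <= t <= 1 by rewrite !ltW.
by have [] := near_r _ (in_ball h s t hr s01 t01).
Qed.

Lemma derive_comm f x v w :
  (\forall y \near x, derivable f y v /\ derivable f y w) ->
  (\forall y \near x, derivable ('D_v f) y w /\ derivable ('D_w f) y v) ->
  {for x, continuous ('D_w ('D_v f))} -> {for x, continuous ('D_v ('D_w f))} ->
  'D_w ('D_v f) x = 'D_v ('D_w f) x.
Proof.
move=> df ddf cvw cwv.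
have dfv : \forall y \near x, derivable f y v by apply: filterS df => y [].
have dfw : \forall y \near x, derivable f y w by apply: filterS df => y [].
have ddfv : \forall y \near x, derivable ('D_v f) y w by apply: filterS ddf => y [].
have ddfw : \forall y \near x, derivable ('D_w f) y v by apply: filterS ddf => y [].
have := mixed_difference_cvg dfw ddfw cwv.
under eq_cvg do rewrite mixed_differenceC.
move: (mixed_difference_cvg dfv ddfv cvw); exact: cvg_unique.
Qed.

End MixedDerivatives.

Section C2Functions.
Context {R : realType} {n : nat}.
Implicit Types (f g : 'rV[R]_n -> R) (x : 'rV[R]_n) (U : set 'rV[R]_n).

Definition hess f x : 'M[R]_n := \matrix_i grad (partial i f) x.

Lemma inf_laplacianE f x : inf_laplacian f x = dot (grad f x *m hess f x) (grad f x).
Proof.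
rewrite dotE /inf_laplacian exchange_big; apply: eq_bigr => j _ /=.
by rewrite !mxE mulr_suml; apply: eq_bigr => i _; rewrite !mxE; ring.
Qed.

Lemma has_jac_C2_on U f (G : 'rV[R]_n -> 'rV[R]_n) (H : 'rV[R]_n -> 'M[R]_n) : open U ->
  (forall x, U x -> has_grad f x (G x)) -> (forall x, U x -> has_jac G x (H x)) ->
  (forall i j x, U x -> {for x, continuous (fun y => H y i j)}) ->
  C2_on U f /\ forall x, U x -> inf_laplacian f x = dot (G x *m H x) (G x).
Proof.
move=> oU fG GH cH.
have gradE x : U x -> grad f x = G x by move=> /fG/grad_val.
have partialE i x : U x -> partial i f x = G x ord0 i by move=> /gradE <-; rewrite mxE.
have fH i x : U x -> has_grad (partial i f) x (row i (H x)).
  move=> Ux; apply: has_grad_near_eq (GH x Ux i).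
  have : \forall y \near x, U y by exact: open_nbhs_nbhs.
  by apply: filterS => y /partialE ->.
have hessE x : U x -> hess f x = H x.
  by move=> Ux; apply/row_matrixP => i; rewrite rowK (grad_val (fH i x Ux)).
have within (h : 'rV[R]_n -> R) : (forall x, U x -> {for x, continuous h}) ->
    {within U, continuous h}.
  by move=> ch; apply: continuous_in_subspaceT => x /set_mem; exact: ch.
split=> [|x Ux]; last by rewrite inf_laplacianE gradE// hessE.
split; first by apply: within => x /fG/has_grad_continuous.
split=> [i|i j]; split.
- by move=> x /fG/(has_grad_is_derive (evec R i)) [].
- by apply: within => x /(fH i)/has_grad_continuous.
- by move=> x /(fH i)/(has_grad_is_derive (evec R j)) [].
- have /(subspace_eq_continuous) : {in U, (fun y => H y i j) =1 partial j (partial i f)}.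
    by move=> x /set_mem /hessE <-; rewrite !mxE.
  by apply; apply: within => x; exact: cH.
Qed.

Section OnOpenSet.
Variables (U : set 'rV[R]_n) (f : 'rV[R]_n -> R).
Hypotheses (oU : open U) (f2 : C2_on U f).

Let within_open (h : 'rV[R]_n -> R) x : {within U, continuous h} -> U x ->
  {for x, continuous h}.
Proof. by rewrite continuous_open_subspace// => ch Ux; apply: ch; exact: mem_set. Qed.

Let near_open x : U x -> \forall y \near x, U y.
Proof. by move=> Ux; exact: open_nbhs_nbhs. Qed.

Lemma C2_on_has_grad x : U x -> has_grad f x (grad f x).
Proof.
case: f2 => _ [f1 _] Ux; apply: continuous_partial_has_grad => [|i].
  by apply: filterS (near_open Ux) => y Uy i; exact: (f1 i).1.
exact: within_open (f1 i).2 Ux.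
Qed.

Lemma C2_on_has_jac x : U x -> has_jac (grad f) x (hess f x).
Proof.
case: f2 => _ [_ f2'] Ux i; rewrite rowK (_ : (fun y => grad f y ord0 i) = partial i f).
  apply: continuous_partial_has_grad => [|j]; last exact: within_open (f2' i j).2 Ux.
  by apply: filterS (near_open Ux) => y Uy j; exact: (f2' i j).1.
by apply/funext => y; rewrite mxE.
Qed.

Lemma C2_on_hess_continuous i j x : U x -> {for x, continuous (fun y => hess f y i j)}.
Proof.
case: f2 => _ [_ f2'] Ux; rewrite (_ : (fun y => _) = partial j (partial i f)).
  exact: within_open (f2' i j).2 Ux.
by apply/funext => y; rewrite !mxE.
Qed.

Lemma C2_on_hess_sym x : U x -> (hess f x)^T = hess f x.
Proof.
case: f2 => _ [f1 f2'] Ux; apply/matrixP => i j; rewrite !mxE.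
apply: derive_comm.
- by apply: filterS (near_open Ux) => y Uy; split; exact: (f1 _).1.
- by apply: filterS (near_open Ux) => y Uy; split; exact: (f2' _ _).1.
- exact: within_open (f2' j i).2 Ux.
- exact: within_open (f2' i j).2 Ux.
Qed.

End OnOpenSet.

Lemma eq_C2_on U U' f g : open U -> open U' -> U' `<=` U ->
  (forall x, U' x -> f x = g x) -> C2_on U f -> C2_on U' g.
Proof.
move=> oU oU' U'U fg f2.
have [|x U'x|i j x /U'U Ux|//] := @has_jac_C2_on U' g (grad f) (hess f) oU'.
- move=> x U'x; apply: has_grad_near_eq (C2_on_has_grad oU f2 (U'U x U'x)).
  have : \forall y \near x, U' y by exact: open_nbhs_nbhs.
  by apply: filterS => y; exact: fg.
- exact: C2_on_has_jac (U'U x U'x).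
- exact: C2_on_hess_continuous Ux.
Qed.

Lemma visc_supersolN U f : visc_supersol U f -> visc_subsol U (fun y => - f y).
Proof.
move=> fsuper x phi Ux [W [oW Wx phi2]] xmax.
have [|y Wy|i j y Wy|phiN2 lapN] := @has_jac_C2_on W (fun y => - phi y)
    (fun y => - grad phi y) (fun y => - hess phi y) oW.
- by move=> y Wy; exact: has_gradN (C2_on_has_grad oW phi2 Wy).
- move=> i; have := has_gradN (C2_on_has_jac oW phi2 Wy i).
  rewrite (_ : - row i _ = row i (- hess phi y)); last by apply/rowP => j; rewrite !mxE.
  rewrite (_ : (fun _ => - _) = fun v => (- grad phi v) ord0 i)//.
  by apply/funext => v; rewrite !mxE.
- rewrite (_ : (fun y => _) = fun v => - hess phi v i j).
    by apply: continuousN; exact: C2_on_hess_continuous Wy.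
  by apply/funext => v; rewrite mxE.
have := fsuper x (fun y => - phi y) Ux; rewrite lapN// mulNmx mulmxN [- - (_ *m _)]opprK dotNr.
rewrite -inf_laplacianE oppr_le0; apply; first by exists W.
by apply: filterS xmax => y; rewrite !opprK; lra.
Qed.

Lemma C2_visc_sol_laplacian U f x : open U -> C2_on U f -> visc_sol U f -> U x ->
  inf_laplacian f x = 0.
Proof.
move=> oU f2 [_ [fsub fsuper]] Ux.
have loc2 : exists W : set 'rV[R]_n, [/\ open W, W x & C2_on W f] by exists U.
apply/eqP; rewrite eq_le; apply/andP; split.
  by apply: fsuper => //; near=> y; rewrite !subrr.
by apply: fsub => //; near=> y; rewrite !subrr.
Unshelve. all: by end_near. Qed.

End C2Functions.

Section BentCone.
Context {R : realType} {n : nat}.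
Variables (z : 'rV[R]_n) (c b g : R).
Implicit Types y : 'rV[R]_n.

(* A perturbation of the cone [c + b |y - z|] that is strictly infinity-superharmonic when
   [g > 0], which the cone itself is not. *)
Definition bent_cone y := c + b * enorm (y - z) - g * dot (y - z) (y - z).

Definition bent_cone_slope y := b * (enorm (y - z))^-1 - 2 * g.

Definition bent_cone_hess y : 'M[R]_n :=
  bent_cone_slope y *: 1%:M + (y - z)^T *m (- (b * enorm (y - z) ^- 3) *: (y - z)).

Lemma bent_cone_continuous : continuous bent_cone.
Proof.
move=> y; have ce : {for y, continuous (fun y => enorm (y - z))} by exact: enormB_continuous.
have cb : {for y, continuous (fun y => b * enorm (y - z))}.
  exact: (continuousM (@cst_continuous _ _ b y) ce).
have cg : {for y, continuous (fun y => c - g * dot (y - z) (y - z))}.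
  exact: has_grad_continuous (has_gradB (has_grad_cst c y) (has_gradZ g (has_grad_sqdist z y))).
rewrite (_ : bent_cone = fun y => b * enorm (y - z) + (c - g * dot (y - z) (y - z))).
  exact: (continuousD cb cg).
by apply/funext => v; rewrite /bent_cone addrA (addrC c).
Qed.

Lemma has_grad_inv_enorm y : y <> z ->
  has_grad (fun y => (enorm (y - z))^-1) y (- (enorm (y - z) ^- 3 *: (y - z))).
Proof.
move=> yz; have r0 : enorm (y - z) != 0 by rewrite gt_eqF// enorm_sub_gt0.
have := has_gradV (f := fun y => enorm (y - z)) r0 (has_grad_enorm yz).
by rewrite scalerA (_ : _ ^- 2 / _ = enorm (y - z) ^- 3)//; field.
Qed.

Lemma has_grad_bent_cone_slope y : y <> z ->
  has_grad bent_cone_slope y (- (b * enorm (y - z) ^- 3) *: (y - z)).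
Proof.
move=> yz; rewrite -[_ *: _]subr0 scaleNr -scalerA -scalerN.
exact: has_gradB (has_gradZ b (has_grad_inv_enorm yz)) (has_grad_cst _ _).
Qed.

Lemma has_grad_bent_cone y : y <> z ->
  has_grad bent_cone y (bent_cone_slope y *: (y - z)).
Proof.
move=> yz; have -> : bent_cone_slope y *: (y - z) =
    0 + b *: ((enorm (y - z))^-1 *: (y - z)) - g *: (2 *: (y - z)).
  by rewrite add0r !scalerA -scalerBl (mulrC g).
apply: has_gradB; last exact: has_gradZ (has_grad_sqdist z y).
exact: has_gradD (has_grad_cst _ _) (has_gradZ _ (has_grad_enorm yz)).
Qed.

Lemma bent_cone_hess_continuous i j y : y <> z ->
  {for y, continuous (fun y => bent_cone_hess y i j)}.
Proof.
move=> yz; have inv := has_grad_inv_enorm yz.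
have entry := has_gradB (has_gradM (has_grad_bent_cone_slope yz) (has_grad_cst (1%:M i j) y))
  (has_gradZ b (has_gradM (has_gradM (has_grad_sqr inv) inv)
    (has_gradM (has_jac_subr z y i) (has_jac_subr z y j)))).
rewrite (_ : (fun y => _) = (fun v => bent_cone_slope v * 1%:M i j -
    b * ((enorm (v - z))^-1 ^+ 2 * (enorm (v - z))^-1 * ((v - z) ord0 i * (v - z) ord0 j)))).
  exact: has_grad_continuous entry.
by apply/funext => v; rewrite !mxE big_ord1 !mxE -exprSr exprVn; ring.
Qed.

Lemma mulmx_bent_cone_hess y : y <> z ->
  (y - z) *m bent_cone_hess y = - (2 * g) *: (y - z).
Proof.
move=> yz; have r0 : enorm (y - z) != 0 by rewrite gt_eqF// enorm_sub_gt0.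
rewrite mulmxDr -scalemxAr mulmx1 mulmxA [_ *m _^T]mx11_scalar -/(dot _ _) -sqr_enorm.
rewrite mul_scalar_mx scalerA -scalerDl; congr (_ *: _).
by rewrite /bent_cone_slope; field.
Qed.

Lemma bent_cone_C2 : C2_on [set y | y <> z] bent_cone /\
  forall y, y <> z -> inf_laplacian bent_cone y =
    - (2 * g * (b - 2 * g * enorm (y - z)) ^+ 2).
Proof.
have [|||C2 lap] := @has_jac_C2_on R n [set y | y <> z] bent_cone
    (fun y => bent_cone_slope y *: (y - z)) bent_cone_hess (open_neq_row (z := z)).
- by move=> y; exact: has_grad_bent_cone.
- by move=> y yz; exact: has_jacZ (has_grad_bent_cone_slope yz) (has_jac_subr z y).
- by move=> i j y; exact: bent_cone_hess_continuous.
split=> // y yz; have r0 : enorm (y - z) != 0 by rewrite gt_eqF// enorm_sub_gt0.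
rewrite lap// -scalemxAl mulmx_bent_cone_hess// !dotZl dotZr -sqr_enorm /bent_cone_slope.
by field.
Qed.

End BentCone.

Section CompactExtrema.
Context {R : realType} {n : nat}.
Implicit Types (A : set 'rV[R]_n) (f : 'rV[R]_n -> R).

Lemma compact_within_max A f : compact A -> A !=set0 -> {within A, continuous f} ->
  exists2 c : 'rV[R]_n, A c & forall x, A x -> f x <= f c.
Proof.
move=> cA A0 cf; have [c /set_mem Ac cmax] := EVT_max_rV A0 cA cf.
by exists c => // x Ax; apply: cmax; exact: mem_set.
Qed.

Lemma compact_max_critical A f (Df : 'rV[R]_n -> 'rV[R]_n) : compact A -> A !=set0 ->
  (forall x, A x -> has_grad f x (Df x)) ->
  exists c, [/\ A c, forall x, A x -> f x <= f c & A° c -> Df c = 0].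
Proof.
move=> cA A0 fDf; have cf : {within A, continuous f}.
  by apply: continuous_in_subspaceT => x /set_mem/fDf/has_grad_continuous.
have [c Ac cmax] := compact_within_max cA A0 cf.
exists c; split => // Aoc.
by apply: has_grad_local_max (fDf c Ac); apply: filterS Aoc => x; exact: cmax.
Qed.

Lemma compact_norm_bound A f : compact A -> (forall x, A x -> {for x, continuous f}) ->
  exists2 M : R, 0 < M & forall x, A x -> `|f x| <= M.
Proof.
move=> cA cf.
have /ex_strict_bound_gt0[M M0 fM] : bounded_set (f @` A).
  apply: compact_bounded; apply: continuous_compact => //.
  by apply: continuous_in_subspaceT => x /set_mem; exact: cf.
by exists M => // x Ax; apply: ltW; apply: fM; exists x.
Qed.

Lemma within_closed_compact A f (B : set R) : compact A -> closed B ->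
  {within A, continuous f} -> compact (A `&` f @^-1` B).
Proof.
move=> cA cB /continuous_closedP/(_ _ cB)/closed_subspaceP[V cV VB].
by rewrite setIC -VB setIC; exact: compact_closedI.
Qed.

End CompactExtrema.

Section Comparison.
Context {R : realType} {n : nat}.
Implicit Types (x y z : 'rV[R]_n) (u phi : 'rV[R]_n -> R) (W : set 'rV[R]_n).

Definition frontier W : set 'rV[R]_n := closure W `\` W.

Lemma strict_comparison W u phi : open W -> bounded_set W ->
  {within closure W, continuous u} -> {within closure W, continuous phi} -> visc_subsol W u ->
  (forall y, W y -> exists V : set 'rV[R]_n, [/\ open V, V y & C2_on V phi]) ->
  (forall y, W y -> inf_laplacian phi y < 0) ->
  (forall y, frontier W y -> u y <= phi y) ->
  forall y, W y -> u y <= phi y.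
Proof.
move=> oW bW cu cphi usub phi2 phi_super u_frontier x Wx.
have cW0 : closure W !=set0 by exists x; exact: subset_closure.
have cuphi : {within closure W, continuous (fun y => u y - phi y)} by exact: within_continuousB.
have [c cWc cmax] := compact_within_max (compact_closure_bounded bW) cW0 cuphi.
have [Wc|nWc] := pselect (W c); last first.
  rewrite -subr_le0 (le_trans (cmax x _)) ?subr_le0 ?u_frontier//.
  exact: subset_closure.
suff : 0 <= inf_laplacian phi c by rewrite leNgt phi_super.
apply: (usub _ _ Wc (phi2 c Wc)).
have : \forall y \near c, W y by exact: open_nbhs_nbhs.
by apply: filterS => y Wy; apply: cmax; exact: subset_closure.
Qed.

Lemma exists_bending (b e M : R) : 0 < e -> 0 <= M -> exists g : R,
  [/\ 0 < g, g * M ^+ 2 <= e & forall r, 0 < r <= M -> b - 2 * g * r != 0].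
Proof.
move=> e0 M0; have M1 : 0 < M + 1 by rewrite ltr_wpDl.
have Msq : 0 < M ^+ 2 + 1 by rewrite ltr_wpDl// sqr_ge0.
have small g : 0 < g -> g <= e / (M ^+ 2 + 1) -> g * M ^+ 2 <= e.
  by move=> g0; rewrite ler_pdivlMr// mulrDr mulr1; lra.
have [b0|b0] := leP b 0.
  have g0 : 0 < e / (M ^+ 2 + 1) by rewrite divr_gt0.
  exists (e / (M ^+ 2 + 1)); split => // [|r /andP[r0 _]]; first exact: small.
  by rewrite lt_eqF// subr_lt0 (le_lt_trans b0)//; do 2?apply: mulr_gt0.
pose g := Num.min (e / (M ^+ 2 + 1)) (b / (4 * (M + 1))).
have g0 : 0 < g by rewrite lt_min !divr_gt0// mulr_gt0.
exists g; split => // [|r /andP[r0 rM]]; first by apply: small; rewrite // ge_min lexx.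
have gb : g * (M + 1) <= b / 4 by rewrite -ler_pdivlMr// -mulrA -invfM ge_min lexx orbT.
have gr : g * r <= g * (M + 1) by rewrite ler_pM2l//; lra.
by rewrite gt_eqF// -mulrA; lra.
Qed.

Lemma cone_comparison W u z (a b : R) : open W -> bounded_set W -> ~ W z ->
  {within closure W, continuous u} -> visc_subsol W u ->
  (forall y, frontier W y -> u y <= a + b * enorm (y - z)) ->
  forall y, W y -> u y <= a + b * enorm (y - z).
Proof.
move=> oW bW Wz cu usub u_frontier x Wx; apply/ler_addgt0Pr => e e0.
have [M WM] := (bounded_enormP W z).1 bW.
have M0 : 0 <= M by apply: le_trans (WM _ Wx); exact: enorm_ge0.
have [g [g0 ge gb]] := exists_bending b e0 M0.
pose phi := bent_cone z (a + g * M ^+ 2) b g.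
have phiE y : phi y = a + b * enorm (y - z) + g * (M ^+ 2 - enorm (y - z) ^+ 2).
  by rewrite /phi /bent_cone sqr_enorm; ring.
suff : u x <= phi x.
  move/le_trans; apply; rewrite phiE lerD2l mulrBr (le_trans _ ge)// gerBl.
  by rewrite mulr_ge0 ?sqr_ge0// ltW.
have neq_z y : W y -> y <> z by move=> Wy yz; apply: Wz; rewrite -yz.
have [phi2 lap] := bent_cone_C2 z (a + g * M ^+ 2) b g.
apply: (strict_comparison oW bW cu _ usub) Wx.
- by apply: continuous_subspaceT => y; exact: bent_cone_continuous.
- by move=> y /neq_z yz; exists [set y | y <> z]; split => //; exact: open_neq_row.
- move=> y Wy; rewrite lap; last exact: neq_z.
  rewrite oppr_lt0; apply: mulr_gt0; first exact: mulr_gt0.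
  by rewrite exprn_even_gt0//= gb// WM// enorm_sub_gt0//; exact: neq_z.
- move=> y Fy; rewrite (le_trans (u_frontier y Fy))// phiE lerDl mulr_ge0 ?(ltW g0)// subr_ge0.
  by rewrite ler_pXn2r ?nnegrE// (closure_enorm_le WM)//; case: Fy.
Qed.

End Comparison.

Section Connected.
Context {R : realType} {n : nat}.
Implicit Types (x y z : 'rV[R]_n) (A O : set 'rV[R]_n).

Lemma pairwise_connected A :
  (forall x y, A x -> A y -> exists C, [/\ connected C, C `<=` A, C x & C y]) -> connected A.
Proof.
move=> conn; have [[x Ax]|/set0P/negP/negPn/eqP ->] := pselect (A !=set0); last exact: connected0.
suff <- : connected_component A x = A by exact: component_connected.
apply/seteqP; split => [|y Ay]; first exact: connected_component_sub.
by have [C [cC CA Cx Cy]] := conn x y Ax Ay; exists C.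
Qed.

Lemma connected_meets_frontier A O x y : connected A -> open O -> A x -> O x -> A y -> ~ O y ->
  exists2 z, A z & frontier O z.
Proof.
move=> cA oO Ax Ox Ay Oy; apply: contrapT => nofrontier.
have : A `&` O = A.
  apply: cA; first by exists x.
    by exists O.
  exists (closure O); first exact: closed_closure.
  apply/seteqP; split => z [Az Oz]; split => //; first exact: subset_closure.
  by apply: contrapT => nOz; apply: nofrontier; exists z.
by move/seteqP => [_ /(_ y Ay)[_]].
Qed.

Definition segment x y : set 'rV[R]_n := (fun t => x + t *: (y - x)) @` `[(0 : R), 1]%classic.

Lemma segment_left x y : segment x y x.
Proof. by exists 0; rewrite ?scale0r ?addr0//= in_itv/= lexx ler01. Qed.

Lemma segment_right x y : segment x y y.
Proof. by exists 1; rewrite ?scale1r ?subrKC//= in_itv/= lexx ler01. Qed.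

Lemma connected_segment x y : connected (segment x y).
Proof.
apply: connected_continuous_connected; first exact: segment_connected.
by apply: continuous_subspaceT => t; exact: shift_line_continuous.
Qed.

Lemma segment_sub_convex O x y : Defs.convex_set O -> O x -> O y -> segment x y `<=` O.
Proof.
move=> convO Ox Oy _ [t + <-]; rewrite /= in_itv/= => t01.
have -> : x + t *: (y - x) = (1 - t) *: x + t *: y by apply/rowP => j; rewrite !mxE; ring.
exact: convO.
Qed.

(* Two points are joined by a detour through [x0 + s w], where [w] is orthogonal to
   [x - x0] and makes no obtuse angle with [y - x0]. *)
Lemma connected_punctured_convex O x0 : (2 <= n)%N -> open O -> Defs.convex_set O -> O x0 ->
  connected (O `\ x0).
Proof.
move=> n2 oO convO Ox0; apply: pairwise_connected => x y [Ox xx0] [Oy yx0].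
have [w [w1 wx wy]] := exists_unit_perp (x - x0) (y - x0) n2.
have /nbhs_eballP[r r0 rO] : nbhs x0 O by exact: open_nbhs_nbhs.
pose s := r / 2; have s0 : 0 < s by rewrite divr_gt0.
pose m := x0 + s *: w.
have Om : O m by apply: rO; rewrite /eball/= enorm_ray ?(ltW s0)// w1 mulr1 /s; lra.
have dot_xm t : dot (x + t *: (m - x) - x0) w = t * s.
  have -> : x + t *: (m - x) - x0 = (1 - t) *: (x - x0) + (t * s) *: w.
    by apply/rowP => j; rewrite !mxE; ring.
  by rewrite !dot_linE !(dotC _ w) -dotBr wx -sqr_enorm w1; ring.
have dot_my t : dot (m + t *: (y - m) - x0) w = (1 - t) * s + t * dot w (y - x0).
  have -> : m + t *: (y - m) - x0 = ((1 - t) * s) *: w + t *: (y - x0).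
    by apply/rowP => j; rewrite !mxE; ring.
  by rewrite dotDl !dotZl (dotC (y - x0)) -sqr_enorm w1; ring.
exists (segment x m `|` segment m y); split; last 2 first.
- by left; exact: segment_left.
- by right; exact: segment_right.
- apply: connectedU; try exact: connected_segment.
  by exists m; split; [exact: segment_right|exact: segment_left].
rewrite subUset; split => v vseg.
- split => [|vx0]; first by apply: segment_sub_convex vseg.
  move: vseg; rewrite {v}vx0 => -[t _ vx0].
  have /eqP := dot_xm t; rewrite vx0 subrr dot0l eq_sym mulf_eq0 (gt_eqF s0) orbF => /eqP t0.
  by apply: xx0; rewrite -vx0 t0 scale0r addr0.
- split => [|vx0]; first by apply: segment_sub_convex vseg.
  move: vseg; rewrite {v}vx0 => -[t]; rewrite /= in_itv/= => /andP[t0 t1] vx0.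
  have := dot_my t; rewrite vx0 subrr dot0l => dot0.
  have t1' : t = 1 by apply/eqP; rewrite eq_le t1 leNgt; apply/negP => ?; nra.
  by apply: yx0; rewrite -vx0 t1' scale1r subrKC.
Qed.

End Connected.

Section InfHarmonicFlow.
Context {R : realType} {n : nat}.
Variables (U : set 'rV[R]_n) (u : 'rV[R]_n -> R).
Hypotheses (oU : open U) (u2 : C2_on U u).
Hypothesis u_inf : forall x, U x -> inf_laplacian u x = 0.
Implicit Types (x y z w : 'rV[R]_n) (A : set 'rV[R]_n).

Definition speed x : R := dot (grad u x) (grad u x).

Definition legendre z x : R := dot (grad u x) (x - z) - u x.

Lemma speed_ge0 x : 0 <= speed x.
Proof. exact: dot_ge0. Qed.

Lemma speed_enorm x : speed x = enorm (grad u x) ^+ 2.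
Proof. by rewrite sqr_enorm. Qed.

Lemma speed_gt0_grad_neq0 x : 0 < speed x -> grad u x <> 0.
Proof. by rewrite /speed => + u0; rewrite u0 dot0l ltxx. Qed.

Lemma has_grad_speed_hess x : U x -> has_grad speed x (2 *: (grad u x *m hess u x)).
Proof.
move=> Ux; have Hx := C2_on_has_jac oU u2 Ux.
by rewrite mulr2n scalerDl scale1r; exact: (has_grad_dot Hx Hx).
Qed.

Lemma has_grad_speed x : U x -> has_grad speed x (grad speed x).
Proof. by move=> Ux; have Ds := has_grad_speed_hess Ux; rewrite (grad_val Ds). Qed.

Lemma has_grad_legendre z x : U x -> has_grad (legendre z) x ((x - z) *m hess u x).
Proof.
move=> Ux; have Du := C2_on_has_grad oU u2 Ux.
have := has_gradB (has_grad_dot (C2_on_has_jac oU u2 Ux) (has_jac_subr z x)) Du.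
by rewrite mulmx1 addrAC subrr add0r.
Qed.

(* This is the invariance of the speed under the gradient flow. *)
Lemma dot_grad_grad_speed x : U x -> dot (grad u x) (grad speed x) = 0.
Proof.
move=> Ux; rewrite (grad_val (has_grad_speed_hess Ux)) dotZr dotC.
by rewrite -inf_laplacianE u_inf// mulr0.
Qed.

Lemma dot_grad_grad_legendre z x : U x ->
  dot (grad u x) ((x - z) *m hess u x) = 2^-1 * dot (grad speed x) (x - z).
Proof.
move=> Ux; rewrite (grad_val (has_grad_speed_hess Ux)) dotZl.
rewrite dotC dot_mulmx (C2_on_hess_sym oU u2)// dotC.
by rewrite mulrA mulVf ?mul1r// pnatr_eq0.
Qed.

Lemma hess_form_continuous z x : U x ->
  {for x, continuous (fun y => dot ((y - z) *m hess u y) (y - z))}.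
Proof.
move=> Ux; rewrite (_ : (fun y => _) = fun y => \sum_(j < n) \sum_(i < n)
    (y - z) ord0 i * hess u y i j * (y - z) ord0 j); last first.
  by apply/funext => y; rewrite dotE; apply: eq_bigr => j _; rewrite mxE mulr_suml.
apply: continuous_sum_ord => j; apply: continuous_sum_ord => i.
have cz k : {for x, continuous (fun y => (y - z) ord0 k)}.
  exact: has_grad_continuous (has_jac_subr z x k).
have ch : {for x, continuous (fun y => hess u y i j)} by exact: C2_on_hess_continuous Ux.
exact: (continuousM (continuousM (cz i) ch) (cz j)).
Qed.

Section Barrier.
Variables (z : 'rV[R]_n) (eta : R).
Hypothesis eta0 : 0 < eta.

Let radial x := dot (grad u x) (x - z).

Let grad_radial x := (x - z) *m hess u x + grad u x.

Let has_grad_radial x : U x -> has_grad radial x (grad_radial x).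
Proof.
move=> Ux; have := has_grad_dot (C2_on_has_jac oU u2 Ux) (has_jac_subr z x).
by rewrite mulmx1 addrC.
Qed.

(* At a point where [speed u = 0] the barrier is low, hence minimal inside the domain.  At
   an interior minimum for [k = 0] the flow is tangent to the sphere centred at [z] but bends
   outwards; the term [k * radial] turns this second-order contradiction into a first-order
   one. *)
Definition flow_barrier (k : R) x := (speed x + eta) * dot (x - z) (x - z) ^+ 2 + k * radial x.

Lemma flow_barrier_critical k x : U x -> has_grad (flow_barrier k) x 0 ->
  [/\ 4 * (speed x + eta) * dot (x - z) (x - z) * radial x +
        k * (speed x + 2^-1 * dot (grad speed x) (x - z)) = 0 &
      dot (x - z) (x - z) ^+ 2 * dot (grad speed x) (x - z) +
        4 * (speed x + eta) * dot (x - z) (x - z) ^+ 2 +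
        k * dot (grad_radial x) (x - z) = 0].
Proof.
move=> Ux crit0; have sq := has_grad_sqr (has_grad_sqdist z x).
have := has_gradD (has_gradM (has_gradD (has_grad_speed Ux) (has_grad_cst eta x)) sq)
  (has_gradZ k (has_grad_radial Ux)).
move=> /grad_val; rewrite (grad_val crit0) addr0 => crit; split.
  have := congr1 (dot (grad u x)) crit.
  rewrite dot0r /grad_radial !(dotDr (grad u x)) !(dotZr _ (grad u x)).
  rewrite (dotDr _ (_ *m _)) dot_grad_grad_speed// dot_grad_grad_legendre// -/(speed x).
  rewrite /radial => /esym E; rewrite -[RHS]E.
  by move: (dot (grad speed x) _) (dot (grad u x) _) (dot (x - z) _) (speed x) => *; ring.
have := congr1 (dot^~ (x - z)) crit; rewrite /= dot0l (dotDl (_ + _)) (dotDl (_ *: _)) !dotZl.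
move=> /esym E; rewrite -[RHS]E.
by move: (dot (x - z) _) (dot (grad speed x) _) (dot (grad_radial x) _) (speed x) => *; ring.
Qed.

Lemma flow_barrier_tangent x : U x -> 0 < dot (x - z) (x - z) ->
  has_grad (flow_barrier 0) x 0 -> radial x = 0.
Proof.
move=> Ux q0 /(flow_barrier_critical Ux)[+ _]; rewrite mul0r addr0 => /eqP.
rewrite mulf_eq0 gt_eqF => [/eqP //|]; apply: mulr_gt0 => //.
by rewrite mulr_gt0// ltr_wpDl ?speed_ge0.
Qed.

Lemma flow_barrier_outward k x : U x -> 0 < dot (x - z) (x - z) -> 0 < k ->
  - (k * dot (grad_radial x) (x - z)) < 4 * eta * dot (x - z) (x - z) ^+ 2 ->
  has_grad (flow_barrier k) x 0 -> 0 < radial x.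
Proof.
move=> Ux q0 k0 small_k /(flow_barrier_critical Ux)[tangential normal].
have qq : 0 < dot (x - z) (x - z) ^+ 2 by rewrite exprn_gt0.
have bends : speed x + 2^-1 * dot (grad speed x) (x - z) < 0.
  rewrite -(pmulr_rlt0 _ qq); have := mulr_ge0 (speed_ge0 x) (ltW qq).
  move: normal small_k.
  move: (dot (x - z) _ ^+ 2) (speed x) (dot (grad speed x) _) (dot (grad_radial x) _) => *.
  by lra.
have fe0 : 0 < 4 * (speed x + eta) * dot (x - z) (x - z).
  by apply: mulr_gt0 => //; rewrite mulr_gt0// ltr_wpDl ?speed_ge0.
have : k * (speed x + 2^-1 * dot (grad speed x) (x - z)) < 0 by rewrite pmulr_rlt0.
by rewrite -(pmulr_rgt0 _ fe0); move: tangential => /eqP; rewrite addr_eq0 => /eqP ->;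
  rewrite oppr_gt0.
Qed.

Lemma flow_barrier_min k A w (B delta : R) : compact A -> A `<=` U -> A w ->
  (forall x, A x -> `|radial x| <= B) -> 0 <= k -> 2 * (k * B) < delta ->
  (forall x, A x -> ~ A° x -> flow_barrier 0 w + delta <= flow_barrier 0 x) ->
  exists x, [/\ A x, forall y, A y -> flow_barrier k x <= flow_barrier k y &
    has_grad (flow_barrier k) x 0].
Proof.
move=> cA AU Aw radialB k0 kB high.
have barrierE y : flow_barrier k y = flow_barrier 0 y + k * radial y.
  by rewrite /flow_barrier mul0r addr0.
pose D x := - ((speed x + eta) *: ((2 * dot (x - z) (x - z)) *: (2 *: (x - z))) +
  dot (x - z) (x - z) ^+ 2 *: (grad speed x + 0) + k *: grad_radial x).
have gD x : A x -> has_grad (fun y => - flow_barrier k y) x (D x).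
  move=> /AU Ux; apply: has_gradN; apply: has_gradD; last exact: has_gradZ (has_grad_radial Ux).
  apply: has_gradM; last exact: has_grad_sqr (has_grad_sqdist z x).
  exact: has_gradD (has_grad_speed Ux) (has_grad_cst eta x).
have [|x [Ax xmin crit]] := compact_max_critical cA _ gD; first by exists w.
have kradial y : A y -> `|k * radial y| <= k * B.
  by move=> /radialB yB; rewrite normrM ger0_norm// ler_wpM2l.
have Aox : A° x.
  apply: contrapT => /(high x Ax) xhigh; have := xmin w Aw; rewrite lerN2 !barrierE.
  have := kradial x Ax; have := kradial w Aw; rewrite !ler_norml => /andP[_ +] /andP[+ _].
  move: kB xhigh; move: (flow_barrier 0 x) (k * radial x) (k * radial w) (k * B).
  by move: (flow_barrier 0 w); clear; move=> *; lra.
exists x; split => // [y /xmin|]; first by rewrite lerN2.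
have := has_gradN (gD x Ax); rewrite (crit Aox) oppr0.
by rewrite (_ : (fun y => - - _) = flow_barrier k)//; apply/funext => y; rewrite opprK.
Qed.

Lemma flow_barrier_low_frontier A w (rho delta : R) : compact A -> A `<=` U -> A w ->
  0 < rho -> (forall x, A x -> rho <= dot (x - z) (x - z)) -> 0 < delta ->
  ~ (forall x, A x -> ~ A° x -> flow_barrier 0 w + delta <= flow_barrier 0 x).
Proof.
move=> cA AU Aw rho0 rhoA delta0 high.
have q0 x : A x -> 0 < dot (x - z) (x - z) by move=> /rhoA; exact: lt_le_trans.
have [B1 B10 radialB] : exists2 B : R, 0 < B & forall x, A x -> `|radial x| <= B.
  by apply: (compact_norm_bound cA) => x /AU/has_grad_radial/has_grad_continuous.
have [B2 B20 formB] : exists2 B : R, 0 < B &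
    forall x, A x -> `|dot (grad_radial x) (x - z)| <= B.
  apply: (compact_norm_bound cA) => x /AU Ux.
  rewrite (_ : (fun y => _) = fun y => dot ((y - z) *m hess u y) (y - z) + radial y).
    have cform := hess_form_continuous (z := z) Ux.
    have cradial := has_grad_continuous (has_grad_radial Ux).
    exact: (continuousD cform cradial).
  by apply/funext => y; rewrite dotDl.
pose mu := Num.min delta (4 * eta * rho ^+ 2).
have mu0 : 0 < mu by rewrite lt_min delta0 !mulr_gt0 ?exprn_gt0.
pose k := mu / (2 * (B1 + B2)).
have k0 : 0 < k by rewrite divr_gt0// mulr_gt0// addr_gt0.
have kB : 2 * (k * B1) + 2 * (k * B2) = mu.
  by rewrite -mulrDr -mulrDr mulrCA divfK// gt_eqF// mulr_gt0// addr_gt0.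
have kB1 := mulr_gt0 k0 B10; have kB2 := mulr_gt0 k0 B20.
have [|x0 [Ax0 min0 /(flow_barrier_tangent (AU _ Ax0) (q0 _ Ax0)) radial0]] :=
  flow_barrier_min cA AU Aw radialB (lexx 0) _ high; first by rewrite mul0r mulr0.
have [|x1 [Ax1 min1 crit1]] := flow_barrier_min cA AU Aw radialB (ltW k0) _ high.
  have mu1 : mu <= delta by rewrite ge_min lexx.
  by rewrite (lt_le_trans _ mu1)// -kB ltrDl mulr_gt0.
have : radial x1 <= 0.
  have min01 := min0 x1 Ax1; have min10 := min1 x0 Ax0.
  rewrite /flow_barrier radial0 !mul0r mulr0 !addr0 in min01 min10.
  rewrite -(pmulr_rle0 _ k0) -(gerDl ((speed x1 + eta) * dot (x1 - z) (x1 - z) ^+ 2)).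
  exact: le_trans min10 min01.
rewrite leNgt (flow_barrier_outward (AU _ Ax1) (q0 _ Ax1) k0 _ crit1)//.
have mu2 : mu <= 4 * eta * rho ^+ 2 by rewrite ge_min lexx orbT.
have kform : - (k * dot (grad_radial x1) (x1 - z)) <= k * B2.
  have := ler_wpM2l (ltW k0) (formB x1 Ax1); rewrite -{1}(gtr0_norm k0) -normrM.
  by apply: le_trans; rewrite -normrN ler_norm.
apply: le_lt_trans kform (lt_le_trans (_ : _ < mu) (le_trans mu2 _)); first by rewrite -kB; lra.
rewrite ler_pM2l ?mulr_gt0// ler_pXn2r ?nnegrE ?(ltW rho0)//; first exact: rhoA.
exact: ltW (q0 _ Ax1).
Qed.

End Barrier.

Lemma speed_shell_gt0 z w (r1 r2 a : R) : 0 < r1 -> 0 < a -> r1 < enorm (w - z) < r2 ->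
  (forall x, r1 <= enorm (x - z) <= r2 -> U x) ->
  (forall x, enorm (x - z) = r1 -> a <= speed x) -> 0 < speed w.
Proof.
move=> r10 a0 /andP[r1w wr2] shellU speed_inner.
rewrite lt_neqAle speed_ge0 andbT; apply/eqP => /esym w0.
have r20 : 0 < r2 by lra.
pose eta := a * r1 ^+ 4 / r2 ^+ 4.
have eta0 : 0 < eta by rewrite divr_gt0 ?mulr_gt0 ?exprn_gt0.
have gradw : grad u w = 0 by apply/eqP; rewrite -enorm_eq0 -sqrf_eq0 -speed_enorm w0.
have barrierE x : flow_barrier z eta 0 x = (speed x + eta) * enorm (x - z) ^+ 4.
  by rewrite /flow_barrier mul0r addr0 -sqr_enorm -exprM.
pose delta := eta * (r2 ^+ 4 - enorm (w - z) ^+ 4).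
have delta0 : 0 < delta.
  by apply: mulr_gt0; rewrite // subr_gt0 ltr_pXn2r ?nnegrE ?enorm_ge0// ltW.
pose A := [set x : 'rV[R]_n | r1 <= enorm (x - z) <= r2].
have Aw : A w by rewrite /A/= !ltW.
apply: (@flow_barrier_low_frontier z eta eta0 A w (r1 ^+ 2) delta) => //.
- exact: compact_shell.
- by rewrite exprn_gt0.
- by move=> x /andP[r1x _]; rewrite -sqr_enorm ler_pXn2r ?nnegrE ?enorm_ge0// ltW.
move=> x Ax nAox; rewrite !barrierE w0 add0r /delta -mulrDr addrC subrK.
have etaE : eta * r2 ^+ 4 = a * r1 ^+ 4 by rewrite /eta divfK// gt_eqF// exprn_gt0.
have /andP[] := Ax; rewrite le_eqVlt => /predU1P[r1x _|r1x].
  rewrite etaE r1x ler_wpM2r ?exprn_ge0 ?enorm_ge0//.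
  by rewrite (le_trans (speed_inner x _))// lerDl ltW.
rewrite le_eqVlt => /predU1P[->|xr2].
  by rewrite ler_wpM2r ?exprn_ge0 ?(ltW r20)// lerDr speed_ge0.
case: nAox; have : \forall y \near x, r1 < enorm (y - z) < r2.
  by apply: open_nbhs_nbhs; split; [exact: open_shell|rewrite /= r1x].
by apply: filterS => y /andP[r1y yr2]; rewrite /A/= !ltW.
Qed.

Lemma speed_ball_gt0 z w (r : R) : (forall x, enorm (x - z) <= r -> U x) ->
  enorm (w - z) < r -> 0 < speed z -> 0 < speed w.
Proof.
move=> ballU wr z0; have Uz : U z.
  by apply: ballU; rewrite subrr enorm0 (le_trans _ (ltW wr))// enorm_ge0.
have half : speed z / 2 < speed z by rewrite ltr_pdivrMr// ltr_pMr// ltr1n.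
have : \forall x \near z, speed z / 2 < speed x.
  exact: cvgr_gt (has_grad_continuous (has_grad_speed Uz)) _ half.
move=> /nbhs_eballP[e e0 near_z].
have [we|we] := ltP (enorm (w - z)) e; first by apply: lt_trans (near_z w we); rewrite divr_gt0.
apply: (@speed_shell_gt0 z w (e / 2) r (speed z / 2)); rewrite ?divr_gt0 ?wr ?andbT//.
- by lra.
- by move=> x /andP[_]; exact: ballU.
- by move=> x xe; apply: ltW; apply: near_z; rewrite /eball/= xe; lra.
Qed.

Lemma open_speed_eq0 : open [set x | U x /\ speed x = 0].
Proof.
rewrite openE => x [Ux x0]; have /nbhs_eballP[r r0 rU] : nbhs x U by exact: open_nbhs_nbhs.
suff near_x (z : 'rV[R]_n) : enorm (z - x) < r / 2 -> U z /\ speed z = 0.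
  by apply/nbhs_eballP; exists (r / 2) => //; rewrite divr_gt0.
move=> zx; split; first by apply: rU; rewrite /eball/=; lra.
apply/eqP; rewrite eq_le speed_ge0 andbT leNgt; apply/negP => z0.
suff : 0 < speed x by rewrite x0 ltxx.
apply: (@speed_ball_gt0 z x (r / 2)) => //; last by rewrite enormBC.
move=> y yz; apply: rU; rewrite /eball/= (le_lt_trans (ler_enorm_distD z y x))//.
by rewrite (splitr r) ler_ltD.
Qed.

Lemma open_speed_gt0 : open [set x | U x /\ 0 < speed x].
Proof.
rewrite openE => x [Ux x0]; apply: filterI; first exact: open_nbhs_nbhs.
exact: cvgr_gt (has_grad_continuous (has_grad_speed Ux)) _ x0.
Qed.

Lemma connected_speed_gt0 x y : connected U -> U x -> 0 < speed x -> U y -> 0 < speed y.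
Proof.
move=> cU Ux x0 Uy; suff /seteqP[_ /(_ y Uy)[]//] : [set v | U v /\ 0 < speed v] = U.
apply: cU; first by exists x.
  by exists [set v | U v /\ 0 < speed v]; [exact: open_speed_gt0|apply/seteqP; split=> v; case].
exists (~` [set v | U v /\ speed v = 0]); first exact: open_closedC open_speed_eq0.
apply/seteqP; split=> v [Uv v0]; split => //; first by move=> [_ v0']; rewrite v0' ltxx in v0.
by rewrite lt_neqAle speed_ge0 andbT; apply/eqP => v0'; apply: v0.
Qed.

End InfHarmonicFlow.

Section Blowup.
Context {R : realType} {n : nat}.
Variables (x0 : 'rV[R]_n) (u : 'rV[R]_n -> R) (d : R).
Hypotheses (n2 : (2 <= n)%N) (d0 : 0 < d).
Hypothesis u_le1 : forall y, enorm (y - x0) < d -> u y <= 1.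
Hypothesis u_slope : forall x y, 2 * enorm (x - x0) < d -> u x < 1 ->
  enorm (y - x) < enorm (x - x0) ->
  u y <= u x + (1 - u x) / enorm (x - x0) * enorm (y - x).
Implicit Types (a b e : 'rV[R]_n) (A r s t : R).

Definition pole_slope r a := (1 - u (x0 + r *: a)) / r.

Let q := pole_slope.

(* Loss of slope at most a factor [1 - A (1 - cos)] when the direction turns by an angle
   and the radius shrinks by [s]. *)
Definition turn_bound A s := forall a b r t, enorm a = 1 -> enorm b = 1 ->
  0 <= dot a b -> 0 < r -> 2 * r < d -> 0 < t <= s * r ->
  q r a * (1 - A * (1 - dot a b)) <= q t b.

Lemma pole_slopeE r a : 0 < r -> u (x0 + r *: a) = 1 - r * q r a.
Proof. by move=> r0; rewrite /q /pole_slope mulrCA mulfV ?gt_eqF// mulr1; lra. Qed.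

Lemma pole_slope_ge0 r a : enorm a = 1 -> 0 < r < d -> 0 <= q r a.
Proof.
move=> a1 /andP[r0 rd]; rewrite divr_ge0 ?(ltW r0)// subr_ge0 u_le1//.
by rewrite enorm_ray ?(ltW r0)// a1 mulr1.
Qed.

Lemma turn_bound_half : turn_bound 2 2^-1.
Proof.
move=> a b r t a1 b1 ab r0 rd /andP[t0 tr].
have qt : 0 <= q t b by apply: pole_slope_ge0; rewrite // t0/=; lra.
have qr : 0 <= q r a by apply: pole_slope_ge0; rewrite // r0/=; lra.
have ab1 := dot_unit_le1 a1 b1.
have [ab2|ab2] := leP (dot a b) 2^-1; first by apply: le_trans qt; rewrite mulr_ge0_le0//; lra.
have [u1|u1] := leP 1 (u (x0 + r *: a)).
  apply: le_trans qt; rewrite mulr_le0_ge0//; last by lra.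
  by rewrite /q /pole_slope pmulr_lle0 ?invr_gt0// subr_le0.
pose x := x0 + r *: a; pose y := x0 + t *: b.
have yxE : enorm (y - x) ^+ 2 = (r - t) ^+ 2 + 2 * r * t * (1 - dot a b).
  have -> : y - x = t *: b - r *: a by rewrite opprD addrACA subrr add0r.
  by rewrite sqr_enorm !dot_linE -!sqr_enorm a1 b1 (dotC b a); ring.
have xr : enorm (x - x0) = r by rewrite enorm_ray ?(ltW r0)// a1 mulr1.
have yx0 := enorm_ge0 (y - x).
have yxr : enorm (y - x) < r.
  rewrite -(@ltr_pXn2r _ 2%N) ?nnegrE ?(ltW r0)// yxE.
  have rc : 0 < r * (dot a b - 2^-1) by rewrite mulr_gt0// subr_gt0.
  have : 0 < t * (2 * r * dot a b - t) by rewrite mulr_gt0//; lra.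
  by lra.
have yx_le : enorm (y - x) <= r - t + 2 * t * (1 - dot a b).
  have tab : 0 <= t * (1 - dot a b) by rewrite mulr_ge0 ?(ltW t0)// subr_ge0.
  rewrite -(@ler_pXn2r _ 2%N) ?nnegrE// ?yxE; [nra|lra].
have := @u_slope x y; rewrite xr -[(1 - u x) / r]/(q r a) => /(_ rd u1 yxr).
rewrite !pole_slopeE// => slope; rewrite -(ler_pM2l t0).
have := ler_wpM2l qr yx_le; move: slope.
by move: (q r a) (q t b) (enorm (y - x)) (dot a b) => *; lra.
Qed.

Lemma turn_bound_bisect A s : 0 <= A <= 2 -> 0 < s <= 1 -> turn_bound A s ->
  turn_bound (3 / 5 * A) (s * s).
Proof.
move=> /andP[A0 A2] /andP[s0 s1] boundA a b r t a1 b1 ab r0 rd /andP[t0 ts].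
have ab1 := dot_unit_le1 a1 b1.
have [m [m1 am mb loss]] := exists_unit_bisector a1 b1 ab.
have sr : 0 < s * r by rewrite mulr_gt0.
have sr1 : s * r <= r by rewrite ler_piMl// ltW.
pose l := 3 / 10 * A * (1 - dot a b).
have l0 : 0 <= l by rewrite !mulr_ge0// subr_ge0.
have l1 : l <= 1.
  have : A * (1 - dot a b) <= 2 * 1 by apply: ler_pM => //; lra.
  by rewrite /l; lra.
have lossA : A * (1 - dot a m) <= l by have := ler_wpM2l A0 loss; rewrite /l; lra.
have qr : 0 <= q r a by apply: pole_slope_ge0; rewrite // r0/=; lra.
have qs : 0 <= q (s * r) m by apply: pole_slope_ge0; rewrite // sr/=; lra.
have first_half : q r a * (1 - l) <= q (s * r) m.
  apply: le_trans (boundA a m r (s * r) a1 m1 am r0 rd _); last by rewrite sr lexx.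
  by rewrite ler_wpM2l//; lra.
have second_half : q (s * r) m * (1 - l) <= q t b.
  apply: le_trans (boundA m b (s * r) t m1 b1 _ sr _ _); rewrite ?mb//; last 2 first.
  - by lra.
  - by rewrite t0 mulrA.
  by rewrite ler_wpM2l//; lra.
apply: le_trans second_half; apply: le_trans (ler_wpM2r _ first_half); last by rewrite subr_ge0.
by rewrite -(mulrA (q r a)) ler_wpM2l//; have := sqr_ge0 l; rewrite /l; lra.
Qed.

Lemma exists_turn_bound A : 0 < A -> exists2 s, 0 < s <= 1 & turn_bound A s.
Proof.
move=> A0.
have iter k : exists2 s, 0 < s <= 1 & turn_bound (2 * (3 / 5) ^+ k) s.
  elim: k => [|k [s /andP[s0 s1] bound_k]].
    by exists 2^-1; [lra|rewrite expr0 mulr1; exact: turn_bound_half].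
  exists (s * s); first by rewrite mulr_gt0// mulr_ile1// ltW.
  rewrite exprS mulrCA; apply: turn_bound_bisect => //; last by rewrite s0.
  have : (3 / 5 : R) ^+ k <= 1 by rewrite exprn_ile1//; lra.
  by have : 0 <= (3 / 5 : R) ^+ k by [rewrite exprn_ge0//; lra]; lra.
have : (fun k => (3 / 5 : R) ^+ k) @ \oo --> (0 : R).
  by apply: cvg_expr; rewrite ger0_norm; lra.
move=> /cvgrPdist_lt /(_ (A / 2)); rewrite divr_gt0// => /(_ isT) [k _ /(_ k (leqnn k))].
rewrite /= sub0r normrN ger0_norm ?exprn_ge0// => small_k.
have [s s01 bound_k] := iter k; exists s => // a b r t a1 b1 ab r0 rd ts.
apply: le_trans (bound_k a b r t a1 b1 ab r0 rd ts); rewrite ler_wpM2l//.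
  by apply: pole_slope_ge0; rewrite // r0/=; lra.
have : 2 * (3 / 5) ^+ k <= A by lra.
by rewrite lerD2l lerN2 => /ler_wpM2r; apply; rewrite subr_ge0 dot_unit_le1.
Qed.

Variable e : 'rV[R]_n.
Hypothesis e1 : enorm e = 1.
Hypothesis u_ray : forall r, 0 < r < d -> u (x0 + r *: e) = 1 - d^-1 * r.

(* Any direction is reached from [e] in two turns of at most a right angle each. *)
Lemma blowup_ge_cone (eps : R) : 0 < eps -> exists2 r0 : R, 0 < r0 &
  forall x, 0 < enorm (x - x0) < r0 -> (d^-1 - eps) * enorm (x - x0) <= 1 - u x.
Proof.
move=> eps0; have di : 0 < d^-1 by rewrite invr_gt0.
pose A := Num.min 1 (eps * d / 2).
have A0 : 0 < A by rewrite lt_min ltr01/= !mulr_gt0.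
have A1 : A <= 1 by rewrite ge_min lexx.
have Ad : d^-1 * A <= eps / 2.
  by rewrite ler_pdivrMl// mulrC mulrAC ge_min lexx orbT.
have [s /andP[s0 s1] boundA] := exists_turn_bound A0.
have d4 : 0 < d / 4 by rewrite divr_gt0.
have s4 : 0 < s * (d / 4) by rewrite mulr_gt0.
have s4d : s * (d / 4) <= d / 4 by rewrite ler_piMl// ltW.
exists (s * (s * (d / 4))); first by rewrite mulr_gt0.
move=> x /andP[t0 tr]; set t := enorm (x - x0) in t0 tr *.
pose b := t^-1 *: (x - x0).
have b1 : enorm b = 1 by apply: enorm_normalize; rewrite -enorm_gt0.
have xE : x = x0 + t *: b by rewrite scalerA mulfV ?gt_eqF// scale1r subrKC.
have [z [z1 ze zb]] := exists_unit_perp e b n2.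
have qe : q (d / 4) e = d^-1.
  rewrite /q /pole_slope u_ray; last by rewrite d4/=; lra.
  by rewrite opprB addrC subrK mulfK// gt_eqF.
have qez : d^-1 * (1 - A) <= q (s * (d / 4)) z.
  rewrite -qe; have := boundA e z (d / 4) (s * (d / 4)) e1 z1.
  by rewrite dotC ze subr0 mulr1; apply; [| |lra|rewrite s4 lexx].
have qzb : q (s * (d / 4)) z * (1 - A) <= q t b.
  apply: (@le_trans _ _ (q (s * (d / 4)) z * (1 - A * (1 - dot z b)))).
    rewrite ler_wpM2l//; first by apply: pole_slope_ge0; rewrite // s4/=; lra.
    by rewrite lerD2l lerN2 ler_piMr ?(ltW A0)// gerBl.
  by apply: boundA => //; [lra|rewrite t0 ltW].
have -> : 1 - u x = q t b * t by rewrite /q /pole_slope -xE divfK// gt_eqF.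
rewrite ler_wpM2r ?(ltW t0)//; apply: le_trans qzb.
apply: le_trans (ler_wpM2r _ qez); last by rewrite subr_ge0.
have : 0 <= d^-1 * A * A by rewrite !mulr_ge0// ltW.
by move: Ad; move: (d^-1) => di' *; lra.
Qed.

End Blowup.

Section Frontier.
Context {R : realType} {n : nat}.
Implicit Types (O W : set 'rV[R]_n) (x y z : 'rV[R]_n).

Lemma open_punctured O x : open O -> open (O `\ x).
Proof. by move=> oO; rewrite setDE; apply: openI => //; exact: open_neq_row. Qed.

Lemma frontier_punctured O x y : frontier (O `\ x) y -> frontier O y \/ y = x.
Proof.
move=> [cy nOxy]; have [->|/eqP yx] := eqVneq y x; [by right|left]; split.
  by move: y cy {nOxy yx}; apply: closureS => z [].
by move=> Oy; apply: nOxy; split.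
Qed.

Lemma segment_enorm_le x y z : segment x y z -> enorm (z - x) <= enorm (y - x).
Proof.
move=> [t + <-]; rewrite /= in_itv/= => /andP[t0 t1].
by rewrite enorm_ray// ler_piMl ?enorm_ge0.
Qed.

Lemma frontier_closer O x y : open O -> O x -> ~ O y ->
  exists2 z, frontier O z & enorm (z - x) <= enorm (y - x).
Proof.
move=> oO Ox Oy; have [z xyz Fz] := connected_meets_frontier (@connected_segment _ _ x y)
  oO (segment_left x y) Ox (segment_right x y) Oy.
by exists z => //; exact: segment_enorm_le.
Qed.

Definition nearest_frontier_point O x y :=
  frontier O y /\ forall z, frontier O z -> enorm (y - x) <= enorm (z - x).

Lemma exists_nearest_frontier_point O x : (0 < n)%N -> open O -> bounded_set O -> O x ->
  exists y, nearest_frontier_point O x y.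
Proof.
move=> n0 oO bO Ox; have [M OM] := (bounded_enormP O x).1 bO.
have nO : ~ O (x + (M + 1) *: evec R (Ordinal n0)).
  have M0 : 0 <= M + 1 by have := OM x Ox; rewrite subrr enorm0; lra.
  by move=> /OM; rewrite enorm_ray// enorm_evec; lra.
have [z Fz _] := frontier_closer oO Ox nO.
have cF : compact (frontier O).
  rewrite /frontier setDE; apply: compact_closedI; last exact: open_closedC.
  exact: compact_closure_bounded.
have cdist : {within frontier O, continuous (fun y => - enorm (y - x))}.
  apply: continuous_subspaceT => y.
  have cy : {for y, continuous (fun y => enorm (y - x))} by exact: enormB_continuous.
  exact: (continuousN cy).
have [|y Fy ymin] := compact_within_max cF _ cdist; first by exists z.
by exists y; split => // v /ymin; rewrite lerN2.
Qed.

Lemma eball_sub_nearest O x y : open O -> O x -> nearest_frontier_point O x y ->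
  eball x (enorm (y - x)) `<=` O.
Proof.
move=> oO Ox [_ ymin] z; rewrite /eball/= => zx; apply: contrapT => nOz.
have [v /ymin yv vz] := frontier_closer oO Ox nOz.
by have := le_trans yv vz; rewrite leNgt zx.
Qed.

Lemma open_sub_eball O x (r : R) : open O -> 0 < r ->
  (forall y, O y -> enorm (y - x) <= r) -> O `<=` eball x r.
Proof.
move=> oO r0 le_r y Oy; rewrite /eball/= lt_neqAle le_r// andbT; apply/eqP => yr.
have /nbhs_eballP[e e0 eO] : nbhs y O by exact: open_nbhs_nbhs.
have s0 : 0 < e / (2 * r) by rewrite divr_gt0// mulr_gt0.
have : O (y + (e / (2 * r)) *: (y - x)).
  apply: eO; rewrite /eball/= enorm_ray ?(ltW s0)// yr invfM mulrA divfK ?gt_eqF//.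
  by rewrite ltr_pdivrMr// ltr_pMr// ltr1n.
move/le_r; have -> : y + (e / (2 * r)) *: (y - x) - x = (1 + e / (2 * r)) *: (y - x).
  by apply/rowP => j; rewrite !mxE; ring.
by rewrite enormZ yr gtr0_norm ?addr_gt0// ger_pMl// gerDl leNgt s0.
Qed.

End Frontier.

Section Potential.
Context {R : realType} {n : nat}.
Variables (O : set 'rV[R]_n) (x0 : 'rV[R]_n) (u : 'rV[R]_n -> R).
Hypotheses (oO : open O) (bO : bounded_set O) (Ox0 : O x0).
Hypothesis hu : inf_harmonic_potential O x0 u.
Implicit Types (x y z : 'rV[R]_n) (W : set 'rV[R]_n) (a b : R).

Lemma potential_frontier y : frontier O y -> u y = 0.
Proof. by case: hu => _ _ u_frontier _; exact: u_frontier. Qed.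

Lemma potential_pole : u x0 = 1.
Proof. by case: hu. Qed.

Lemma potential_continuous : {within closure O, continuous u}.
Proof. by case: hu. Qed.

Let bounded_sub W : W `<=` O `\ x0 -> bounded_set W.
Proof. by move=> WO; apply: sub_boundedr bO => P OP x /WO[/OP]. Qed.

Lemma potential_cone_le W z a b : open W -> W `<=` O `\ x0 -> ~ W z ->
  (forall y, frontier W y -> u y <= a + b * enorm (y - z)) ->
  forall y, W y -> u y <= a + b * enorm (y - z).
Proof.
move=> oW WO Wz u_frontier; have WO' : W `<=` O by move=> y /WO[].
case: hu => cu [_ [usub _]] _ _; apply: cone_comparison => //.
- exact: bounded_sub WO.
- exact: continuous_subspaceW (closureS WO') cu.
- by move=> y phi /WO; exact: usub.
Qed.

Lemma potential_cone_ge W z a b : open W -> W `<=` O `\ x0 -> ~ W z ->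
  (forall y, frontier W y -> a + b * enorm (y - z) <= u y) ->
  forall y, W y -> a + b * enorm (y - z) <= u y.
Proof.
move=> oW WO Wz u_frontier; have WO' : W `<=` O by move=> y /WO[].
have oppE y : - (a + b * enorm (y - z)) = - a + - b * enorm (y - z) by rewrite opprD mulNr.
move=> y Wy; rewrite -lerN2 oppE; move: y Wy.
case: hu => cu [_ [_ /visc_supersolN usub]] _ _; apply: cone_comparison => //.
- exact: bounded_sub WO.
- by move=> y; apply: continuousN; exact: (continuous_subspaceW (closureS WO') cu).
- by move=> y phi /WO; exact: usub.
- by move=> y /u_frontier; rewrite -oppE lerN2.
Qed.

Lemma potential_le z a b : ~ (O `\ x0) z ->
  (forall y, frontier O y -> 0 <= a + b * enorm (y - z)) -> 1 <= a + b * enorm (x0 - z) ->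
  forall y, O y -> u y <= a + b * enorm (y - z).
Proof.
move=> Oz above above_pole y Oy; have [->|/eqP yx0] := eqVneq y x0; first by rewrite potential_pole.
apply: (@potential_cone_le (O `\ x0)) => //; first exact: open_punctured.
by move=> v /frontier_punctured[Fv|->]; rewrite ?potential_pole// potential_frontier// above.
Qed.

Lemma potential_ge z a b : ~ (O `\ x0) z ->
  (forall y, frontier O y -> a + b * enorm (y - z) <= 0) -> a + b * enorm (x0 - z) <= 1 ->
  forall y, O y -> a + b * enorm (y - z) <= u y.
Proof.
move=> Oz below below_pole y Oy; have [->|/eqP yx0] := eqVneq y x0; first by rewrite potential_pole.
apply: (@potential_cone_ge (O `\ x0)) => //; first exact: open_punctured.
by move=> v /frontier_punctured[Fv|->]; rewrite ?potential_pole// potential_frontier// below.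
Qed.

Let not_punctured : ~ (O `\ x0) x0.
Proof. by move=> [_]; apply. Qed.

Lemma potential_le1 y : O y -> u y <= 1.
Proof.
move=> Oy; have := @potential_le x0 1 0 not_punctured _ _ y Oy; rewrite !mul0r !addr0.
by apply => // z _; rewrite mul0r addr0.
Qed.

Lemma potential_ge0 y : O y -> 0 <= u y.
Proof.
move=> Oy; have := @potential_ge x0 0 0 not_punctured _ _ y Oy; rewrite !mul0r !addr0.
by apply => // z _; rewrite mul0r addr0.
Qed.

Section Inradius.
Variable ys : 'rV[R]_n.
Hypothesis ys_nearest : nearest_frontier_point O x0 ys.
Local Notation d := (enorm (ys - x0)).

Lemma inradius_gt0 : 0 < d.
Proof.
case: ys_nearest => -[_ nOys] _; apply: enorm_sub_gt0 => ysx0.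
by apply: nOys; rewrite ysx0.
Qed.

Let ball_sub y : enorm (y - x0) < d -> O y.
Proof. by move=> yd; exact: (eball_sub_nearest oO Ox0 ys_nearest). Qed.

Lemma potential_ge_cone y : O y -> 1 - d^-1 * enorm (y - x0) <= u y.
Proof.
move=> Oy; rewrite -mulNr; apply: potential_ge => // [z /(proj2 ys_nearest) zd|].
  by rewrite mulNr subr_le0 ler_pdivlMl ?inradius_gt0// mulr1.
by rewrite subrr enorm0 mulr0 addr0.
Qed.

Lemma potential_on_ray (s : R) : 0 <= s < 1 -> u (x0 + s *: (ys - x0)) = 1 - s.
Proof.
move=> /andP[s0 s1]; have d0 := inradius_gt0.
have sd : d^-1 * (s * d) = s by rewrite mulrCA mulVf ?mulr1// gt_eqF.
have Os : O (x0 + s *: (ys - x0)) by apply: ball_sub; rewrite enorm_ray// gtr_pMl.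
apply/eqP; rewrite eq_le; apply/andP; split; last first.
  by apply: le_trans (potential_ge_cone Os); rewrite enorm_ray// sd.
apply: le_trans (@potential_le ys 0 d^-1 _ _ _ _ Os) _.
- by move=> [Oys _]; case: ys_nearest => -[_ nOys] _.
- by move=> y _; rewrite add0r mulr_ge0 ?invr_ge0 ?enorm_ge0.
- by rewrite add0r (enormBC x0) mulVf// gt_eqF.
have -> : x0 + s *: (ys - x0) - ys = (s - 1) *: (ys - x0) by apply/rowP => j; rewrite !mxE; ring.
rewrite add0r enormZ ler0_norm ?subr_le0 ?(ltW s1)// opprB.
by rewrite mulrBl mul1r mulrBr sd mulVf ?gt_eqF.
Qed.

Lemma potential_lipschitz x y : O x -> O y -> u y <= u x + d^-1 * enorm (y - x).
Proof.
move=> Ox Oy; have d0 : 0 <= d^-1 by rewrite invr_ge0 ltW// inradius_gt0.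
have at_pole : 1 <= u x + d^-1 * enorm (x0 - x).
  by have := potential_ge_cone Ox; rewrite (enormBC x0); lra.
have [->|/eqP yx0] := eqVneq y x0; first by rewrite potential_pole.
have [->|/eqP yx] := eqVneq y x; first by rewrite subrr enorm0 mulr0 addr0.
apply: (@potential_cone_le ((O `\ x0) `\ x)) => //.
- by do 2?apply: open_punctured.
- by move=> [_]; apply.
move=> v /frontier_punctured[/frontier_punctured[Fv|->]|->].
- by rewrite potential_frontier// addr_ge0 ?potential_ge0// mulr_ge0 ?enorm_ge0.
- by rewrite potential_pole.
- by rewrite subrr enorm0 mulr0 addr0.
Qed.

Lemma potential_ball_slope x y : 2 * enorm (x - x0) < d -> u x < 1 ->
  enorm (y - x) < enorm (x - x0) ->
  u y <= u x + (1 - u x) / enorm (x - x0) * enorm (y - x).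
Proof.
move=> xd ux yx; have xx0 : x <> x0 by move=> E; move: ux; rewrite E potential_pole ltxx.
have r0 := enorm_sub_gt0 xx0.
have closure_ball z : enorm (z - x) <= enorm (x - x0) -> O z.
  by move=> zx; apply: ball_sub; have := ler_enorm_distD x z x0; lra.
have [->|/eqP yx'] := eqVneq y x; first by rewrite subrr enorm0 mulr0 addr0.
apply: (@potential_cone_le (eball x (enorm (x - x0)) `\ x)) => //.
- by apply: open_punctured; exact: open_eball.
- move=> z [zx _]; split; first by apply: closure_ball; exact: ltW.
  by move=> E; move: zx; rewrite /eball/= E enormBC ltxx.
- by move=> [_]; apply.
move=> v /frontier_punctured[[cv nv]|->]; last by rewrite subrr enorm0 mulr0 addr0.
have vx : enorm (v - x) <= enorm (x - x0) by apply: closure_enorm_le cv => z /ltW.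
have -> : enorm (v - x) = enorm (x - x0).
  by apply/eqP; rewrite eq_le vx leNgt; apply/negP.
by rewrite divfK ?gt_eqF// addrC subrK; apply: potential_le1; exact: closure_ball.
Qed.

Section BlowupAtPole.
Hypothesis n2 : (2 <= n)%N.

Lemma potential_blowup (eps : R) : 0 < eps -> exists2 r0 : R, 0 < r0 &
  forall x, 0 < enorm (x - x0) < r0 -> (d^-1 - eps) * enorm (x - x0) <= 1 - u x.
Proof.
have d0 := inradius_gt0; apply: (blowup_ge_cone n2 d0 _ _ (e := d^-1 *: (ys - x0))).
- by move=> y yd; apply: potential_le1; exact: ball_sub.
- exact: potential_ball_slope.
- by apply: enorm_normalize; rewrite -enorm_gt0.
move=> r /andP[r0 rd]; rewrite scalerA mulrC; apply: potential_on_ray.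
by rewrite mulr_ge0 ?invr_ge0 ?ltW//= mulrC ltr_pdivrMr// mul1r.
Qed.

Lemma potential_le_cone_on_ray x : x <> x0 ->
  (forall s : R, 0 < s <= 1 -> 1 - u (x0 + s *: (x - x0)) <= s * (1 - u x)) ->
  d^-1 * enorm (x - x0) <= 1 - u x.
Proof.
move=> /enorm_sub_gt0; set l := enorm (x - x0) => l0 ray; apply/ler_addgt0Pr => e e0.
have [r0 r00 near_pole] := potential_blowup (divr_gt0 e0 l0).
pose s := Num.min 1 (r0 / (2 * l)).
have s0 : 0 < s by rewrite lt_min ltr01 divr_gt0// mulr_gt0.
have s1 : s <= 1 by rewrite ge_min lexx.
have sl : s * l < r0.
  have : s * (2 * l) <= r0 by rewrite -ler_pdivlMr ?mulr_gt0// ge_min lexx orbT.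
  by lra.
have /near_pole : 0 < enorm (x0 + s *: (x - x0) - x0) < r0.
  by rewrite enorm_ray ?(ltW s0)// mulr_gt0.
rewrite enorm_ray ?(ltW s0)// -/l => /le_trans/(_ (ray s _)).
rewrite s0 s1 => /(_ isT); rewrite mulrCA ler_pM2l// mulrBl divfK ?gt_eqF//.
by rewrite lerBlDr.
Qed.

End BlowupAtPole.

Section C2Rigidity.
Hypothesis n2 : (2 <= n)%N.
Hypothesis convO : Defs.convex_set O.
Hypothesis u2 : C2_on (O `\ x0) u.
Implicit Types (r t e : R).

Local Notation Om := (O `\ x0).
Local Notation G := (legendre u x0).

Let d0 : 0 < d. Proof. exact: inradius_gt0. Qed.
Let oOm : open Om. Proof. exact: open_punctured. Qed.

Let u_inf x : Om x -> inf_laplacian u x = 0.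
Proof. by case: hu => _ usol _ _; exact: C2_visc_sol_laplacian. Qed.

Let Om_near x : Om x -> \forall y \near x, Om y.
Proof. by move=> Omx; exact: open_nbhs_nbhs. Qed.

Let Om_dist_gt0 x : Om x -> 0 < enorm (x - x0).
Proof. by move=> [_ xx0]; exact: enorm_sub_gt0. Qed.

Let ball_Om x : 0 < enorm (x - x0) < d -> Om x.
Proof.
move=> /andP[x_gt0 xd]; split; first exact: ball_sub.
by move=> xx0; move: x_gt0; rewrite xx0 subrr enorm0 ltxx.
Qed.

Let Du x : Om x -> has_grad u x (grad u x).
Proof. exact: C2_on_has_grad. Qed.

Lemma enorm_grad_potential_le x : Om x -> enorm (grad u x) <= d^-1.
Proof.
move=> Omx; apply: has_grad_growth_le (Du Omx); first by rewrite invr_ge0 enorm_ge0.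
apply: filterS (Om_near Omx) => y [Oy _].
by apply: potential_lipschitz Oy; case: Omx.
Qed.

Lemma dot_grad_on_ray t : 0 < t < 1 ->
  dot (grad u (x0 + t *: (ys - x0))) (ys - x0) = -1.
Proof.
move=> /andP[t0 t1]; have Omt : Om (x0 + t *: (ys - x0)).
  by apply: ball_Om; rewrite enorm_ray ?(ltW t0)// mulr_gt0// gtr_pMl.
have line := has_grad_line (Du Omt).
have affine : is_derive t (1 : R) (fun s => u (x0 + s *: (ys - x0))) (-1).
  apply: (near_eq_is_derive (f := fun s : R => 1 - s)).
    have : \forall s \near t, s \in `]0, 1[%R.
      by apply: near_in_itvoo; rewrite in_itv/= t0.
    apply: filterS => s; rewrite in_itv/= => /andP[s0 s1].
    by rewrite potential_on_ray// (ltW s0).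
  by have := is_deriveB (is_derive_cst (1 : R) t (1 : R)) (is_derive_id t (1 : R)); rewrite sub0r.
by rewrite -(@derive_val _ _ _ _ _ _ _ line) (@derive_val _ _ _ _ _ _ _ affine).
Qed.

Lemma speed_potential_gt0 x : Om x -> 0 < speed u x.
Proof.
move=> Omx; pose a := x0 + 2^-1 *: (ys - x0).
have half : 0 < (2^-1 : R) < 1 by lra.
have Oma : Om a.
  by apply: ball_Om; rewrite enorm_ray ?invr_ge0//; move: d0; lra.
apply: (connected_speed_gt0 oOm u2 u_inf _ Oma) => //.
  exact: connected_punctured_convex.
rewrite lt_neqAle speed_ge0 andbT speed_enorm eq_sym sqrf_eq0 enorm_eq0; apply/eqP => Pa.
by have /eqP := dot_grad_on_ray half; rewrite Pa dot0l eq_sym oppr_eq0 oner_eq0.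
Qed.

Let grad_neq0 x : Om x -> grad u x <> 0.
Proof. by move=> /speed_potential_gt0/speed_gt0_grad_neq0. Qed.

Lemma potential_lt1 x : Om x -> u x < 1.
Proof.
move=> Omx; have u_le1 y : O y -> u y <= 1 by exact: potential_le1.
rewrite lt_neqAle u_le1 ?andbT; last by case: Omx.
apply/eqP => ux; apply: (grad_neq0 Omx); apply: has_grad_local_max (Du Omx).
by apply: filterS (Om_near Omx) => y [Oy _]; rewrite ux u_le1.
Qed.

Definition level_band t t' : set 'rV[R]_n := closure O `&` u @^-1` `[t, t']%classic.

Lemma compact_level_band t t' : compact (level_band t t').
Proof.
apply: within_closed_compact; first exact: compact_closure_bounded.
  exact: itv_closed.
exact: potential_continuous.
Qed.

Lemma level_band_sub t t' x : 0 < t -> t' < 1 -> level_band t t' x -> Om x.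
Proof.
move=> t0 t'1 [cx]; rewrite /= in_itv/= => /andP[tu ut']; split.
  apply: contrapT => nOx; have := potential_frontier (conj cx nOx).
  by move: tu; lra.
by move=> xx0; move: ut'; rewrite xx0 potential_pole; lra.
Qed.

Lemma level_bandP t t' x : O x -> level_band t t' x <-> t <= u x <= t'.
Proof.
move=> Ox; rewrite /level_band/setI/= in_itv/=; split=> [[]//|tut'].
by split=> //; exact: subset_closure.
Qed.

Lemma level_band_max (F : 'rV[R]_n -> R) (DF : 'rV[R]_n -> 'rV[R]_n) x t t' :
  (forall y, Om y -> has_grad F y (DF y)) -> 0 < t -> t' < 1 -> Om x -> t <= u x <= t' ->
  exists z, [/\ Om z, t <= u z <= t', F x <= F z & [\/ u z = t, u z = t' | DF z = 0]].
Proof.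
move=> FDF t0 t'1 Omx tut'; have band_x : level_band t t' x.
  by apply/level_bandP => //; case: Omx.
have [|z [band_z zmax crit]] := compact_max_critical (compact_level_band (t := t) (t' := t')) _
  (fun y band_y => FDF y (level_band_sub t0 t'1 band_y)).
  by exists x.
have Omz := level_band_sub t0 t'1 band_z; have Oz := proj1 Omz.
have /(level_bandP _ _ Oz)/andP[tz zt'] := band_z.
exists z; split; rewrite ?tz ?zmax//.
have [->|tz'] := eqVneq (u z) t; first exact: Or31.
have [->|zt''] := eqVneq (u z) t'; first exact: Or32.
apply: Or33; apply: crit.
have cu := has_grad_continuous (Du Omz).
have low : \forall y \near z, t < u y by apply: (cvgr_gt _ cu); rewrite lt_def tz' tz.
have high : \forall y \near z, u y < t' by apply: (cvgr_lt _ cu); rewrite lt_neqAle zt'' zt'.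
apply: filterS3 low high (Om_near Omz) => y ty yt' [Oy _].
by apply/level_bandP => //; rewrite !ltW.
Qed.

Let D_speed x : Om x -> has_grad (speed u) x (grad (speed u) x).
Proof. exact: has_grad_speed. Qed.

Let grad_speed_perp x : Om x -> dot (grad u x) (grad (speed u) x) = 0.
Proof. exact: dot_grad_grad_speed. Qed.

(* The maximum of [c u - (speed - speed x)^2] cannot be critical, as the derivative of this
   function along the flow is [c speed]. *)
Lemma speed_near_constant x (c lo hi : R) : Om x -> c != 0 -> 0 < lo -> hi < 1 ->
  lo <= u x <= hi -> exists z, [/\ Om z, u z = lo \/ u z = hi, lo <= u z <= hi &
    (speed u z - speed u x) ^+ 2 <= c * (u z - u x)].
Proof.
move=> Omx c0 lo0 hi1 xband.
have [y Omy|z [Omz zband zmax crit]] := @level_band_max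
    (fun y => c * u y - (speed u y - speed u x) ^+ 2)
    (fun y => c *: grad u y - (2 * (speed u y - speed u x)) *: (grad (speed u) y - 0))
    x lo hi _ lo0 hi1 Omx xband.
  apply: has_gradB (has_gradZ c (Du Omy)) (has_grad_sqr _).
  exact: has_gradB (D_speed Omy) (has_grad_cst _ _).
exists z; split => //; last first.
  by move: zmax; rewrite subrr expr0n/= subr0 mulrBr; lra.
case: crit => [->|->|/(congr1 (dot (grad u z)))]; [by left|by right|].
rewrite subr0 dotBr !dotZr grad_speed_perp// mulr0 subr0 dot0r => /eqP.
by rewrite mulf_eq0 (negbTE c0)/= gt_eqF// speed_potential_gt0.
Qed.

Lemma speed_transport x t e : Om x -> 0 < u x -> 0 < t < 1 -> 0 < e ->
  exists z, [/\ Om z, u z = t & `|speed u z - speed u x| <= e].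
Proof.
move=> Omx ux0 /andP[t0 t1] e0; have ux1 := potential_lt1 Omx.
have dist_le z c : `|c| <= 1 -> (speed u z - speed u x) ^+ 2 <= e ^+ 2 * c ->
    `|speed u z - speed u x| <= e.
  move=> c1 sq; rewrite -(@ler_pXn2r _ 2%N) ?nnegrE ?(ltW e0)// real_normK ?num_real//.
  by rewrite (le_trans sq)// ler_piMr ?sqr_ge0// (le_trans (ler_norm c)).
have esq : 0 < e ^+ 2 by rewrite exprn_gt0.
have [tx|tx|tx] := ltgtP t (u x); last by exists x; rewrite subrr normr0 ltW.
- have [|||z [Omz uz zband]] := @speed_near_constant x (- e ^+ 2) t ((1 + u x) / 2) Omx _ t0.
  + by rewrite oppr_eq0 gt_eqF.
  + by lra.
  + by lra.
  rewrite mulNr -mulrN opprB => sq.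
  have uxz : 0 <= u x - u z by rewrite -(pmulr_rge0 _ esq) (le_trans _ sq)// sqr_ge0.
  exists z; split => //; first by case: uz => // uz; lra.
  by apply: dist_le sq; rewrite ger0_norm//; lra.
- have [||||z [Omz uz zband sq]] := @speed_near_constant x (e ^+ 2) (u x / 2) t Omx.
  + by rewrite gt_eqF.
  + by lra.
  + by lra.
  + by lra.
  have uzx : 0 <= u z - u x by rewrite -(pmulr_rge0 _ esq) (le_trans _ sq)// sqr_ge0.
  exists z; split => //; first by case: uz => // uz; lra.
  by apply: dist_le sq; rewrite ger0_norm//; lra.
Qed.

Lemma level_speed_min t : 0 < t < 1 -> exists x, [/\ Om x, u x = t &
  forall y, Om y -> 0 < u y -> speed u x <= speed u y].
Proof.
move=> t01; have /andP[t0 t1] := t01.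
have band_t x : Om x -> u x = t -> level_band t t x.
  by move=> [Ox _] uxt; apply/level_bandP; rewrite // uxt lexx.
have Om_ray : Om (x0 + (1 - t) *: (ys - x0)).
  by apply: ball_Om; rewrite enorm_ray; [|lra]; rewrite mulr_gt0 ?gtr_pMl//; lra.
have [|z [band_z zmin _]] := compact_max_critical (compact_level_band (t := t) (t' := t)) _
  (fun y band_y => has_gradN (D_speed (level_band_sub t0 t1 band_y))).
  by eexists; apply: band_t Om_ray _; rewrite potential_on_ray; lra.
have Omz := level_band_sub t0 t1 band_z.
have uz : u z = t by case: band_z => _; rewrite /= in_itv/= => ?; apply/eqP; rewrite eq_le andbC.
exists z; split => // y Omy uy0; apply/ler_addgt0Pr => e e0.
have [v [Omv uv]] := speed_transport Omy uy0 t01 e0; rewrite ler_distl => /andP[_].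
by apply: le_trans; rewrite -lerN2; apply: zmin; exact: band_t.
Qed.

Lemma exists_min_speed : exists m : R, [/\ 0 < m,
  forall x, Om x -> 0 < u x -> m <= speed u x &
  forall t, 0 < t < 1 -> exists x, [/\ Om x, u x = t & speed u x = m]].
Proof.
have half : 0 < (2^-1 : R) < 1 by lra.
have [x [Omx ux xmin]] := level_speed_min half.
exists (speed u x); split => // [|t t01]; first exact: speed_potential_gt0.
have [y [Omy uy ymin]] := level_speed_min t01; exists y; split => //.
by apply/eqP; rewrite eq_le xmin ?ymin// ?ux ?uy ?invr_gt0//; case/andP: t01.
Qed.

Lemma level_near_pole r : 0 < r -> exists2 t, 0 < t < 1 &
  forall z, Om z -> t <= u z -> enorm (z - x0) < r.
Proof.
move=> r0; pose A := closure O `&` (fun z => enorm (z - x0)) @^-1` [set s | r <= s].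
have cA : compact A.
  apply: within_closed_compact; [exact: compact_closure_bounded|exact: closed_ge|].
  by apply: continuous_subspaceT => z; exact: enormB_continuous.
have far z : Om z -> r <= enorm (z - x0) -> A z.
  by move=> [Oz _] rz; split => //; exact: subset_closure.
have [A0|nA] := pselect (A !=set0); last first.
  exists 2^-1 => [|z Omz _]; first by lra.
  by rewrite ltNge; apply/negP => /(far z Omz) Az; apply: nA; exists z.
have [|c [cc rc] cmax] := compact_within_max (f := u) cA A0.
  by apply: continuous_subspaceW potential_continuous => z [].
have uc : u c < 1.
  have [Oc|nOc] := pselect (O c); last by rewrite potential_frontier.
  by apply: potential_lt1; split => // cx0; move: rc; rewrite /= cx0 subrr enorm0; lra.
exists (Num.max 2^-1 ((1 + u c) / 2)); first by rewrite lt_max gt_max; lra.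
move=> z Omz; rewrite ge_max => /andP[_ uz]; rewrite ltNge; apply/negP => /(far z Omz).
by move=> /cmax; lra.
Qed.

Let DG x : Om x -> has_grad G x ((x - x0) *m hess u x).
Proof. exact: has_grad_legendre. Qed.

Definition flow_defect e c x := (G x - c) * (e * dot (grad u x) (x - x0) -
  2 * (G x - c) * dot ((x - x0) *m hess u x) (x - x0)).

(* The products of the critical equation with [grad u z] and with [z - x0] eliminate the
   derivative of the speed, which bounds [K] independently of it. *)
Lemma flow_defect_critical (m e K c : R) z : Om z -> 0 <= e -> 0 <= K -> m <= speed u z ->
  e *: grad u z - K *: grad (speed u) z - (2 * (G z - c)) *: ((z - x0) *m hess u z) = 0 ->
  e * m * K <= flow_defect e c z.
Proof.
move=> Omz e0 K0 mz crit; rewrite /flow_defect.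
have flow := congr1 (dot (grad u z)) crit; have radial := congr1 (dot^~ (z - x0)) crit.
rewrite dot0r !(dotBr (grad u z)) !(dotZr _ (grad u z)) grad_speed_perp// in flow.
rewrite (dot_grad_grad_legendre oOm u2)// -/(speed u z) in flow.
rewrite /= dot0l (dotBl (_ - _)) (dotBl (_ *: _)) !dotZl in radial.
move: radial flow; move: (dot (grad (speed u) z) _) (dot (grad u z) _) (dot (_ *m _) _) (G z - c).
move=> X W Y g radial flow.
have -> : e * W - 2 * g * Y = K * X by lra.
have -> : g * (K * X) = e * speed u z * K by rewrite mulrCA mulrC; congr (_ * _); lra.
by rewrite ler_wpM2r// ler_wpM2l.
Qed.

Lemma flow_defect_bounded e c t t' : 0 < t -> t' < 1 ->
  exists2 B : R, 0 < B & forall x, level_band t t' x -> `|flow_defect e c x| <= B.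
Proof.
move=> t0 t'1; apply: (compact_norm_bound (compact_level_band (t := t) (t' := t'))) => x.
move=> /(level_band_sub t0 t'1) Omx; have gradient := has_gradB (DG Omx) (has_grad_cst c x).
have cG : {for x, continuous (fun v => G v - c)} := has_grad_continuous gradient.
have c2G := has_grad_continuous (has_gradZ 2 gradient).
have cW := has_grad_continuous (has_gradZ e
  (has_grad_dot (C2_on_has_jac oOm u2 Omx) (has_jac_subr x0 x))).
have cY : {for x, continuous (fun v : 'rV[R]_n => dot ((v - x0) *m hess u v) (v - x0))}.
  exact: (hess_form_continuous oOm u2).
have c2GY := continuousM c2G cY.
have cWY := continuousB cW c2GY.
exact: (continuousM cG cWY).
Qed.

Lemma legendre_near_constant (m : R) x t e : 0 < m ->
  (forall y, Om y -> 0 < u y -> m <= speed u y) -> Om x -> 0 < u x -> speed u x = m ->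
  u x < t < 1 -> 0 < e ->
  exists z, [/\ Om z, u z = t & (G z - G x) ^+ 2 <= e].
Proof.
move=> m0 minf Omx ux0 xm /andP[xt t1] e0; pose lo := u x / 2.
have lo0 : 0 < lo by rewrite divr_gt0.
have [B B0 defectB] := flow_defect_bounded e (G x) lo0 t1.
pose K := (B + 1) / (e * m).
have em : 0 < e * m by rewrite mulr_gt0.
have K0 : 0 < K by rewrite divr_gt0// addr_gt0.
have emK : e * m * K = B + 1 by rewrite mulrC divfK// gt_eqF.
have [y Omy||z [Omz /andP[zlo zt] zmax crit]] := @level_band_max
    (fun y => e * u y - K * (speed u y - m) - (G y - G x) ^+ 2)
    (fun y => e *: grad u y - K *: (grad (speed u) y - 0) -
      (2 * (G y - G x)) *: ((y - x0) *m hess u y - 0)) x lo t _ lo0 t1 Omx.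
- apply: has_gradB (has_grad_sqr (has_gradB (DG Omy) (has_grad_cst _ _))).
  apply: has_gradB (has_gradZ e (Du Omy)) (has_gradZ K _).
  exact: has_gradB (D_speed Omy) (has_grad_cst _ _).
- by rewrite /lo (ltW xt) andbT; lra.
have zm : m <= speed u z by apply: minf => //; lra.
move: zmax; rewrite xm !subrr mulr0 expr0n/= !subr0 => zmax.
have Kz : 0 <= K * (speed u z - m) by rewrite mulr_ge0 ?subr_ge0// ltW.
have sq := sqr_ge0 (G z - G x).
case: crit => [uz|uz|].
- have : e * u z < e * u x by rewrite ltr_pM2l// uz /lo; lra.
  by lra.
- exists z; split => //; have : e * (u z - u x) <= e * 1 by rewrite ler_pM2l// uz; lra.
  by lra.
rewrite !subr0 => /(flow_defect_critical Omz (ltW e0) (ltW K0) zm); rewrite emK.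
have : level_band lo t z by apply/level_bandP; [case: Omz|rewrite zlo zt].
by move=> /defectB; rewrite ler_norml => /andP[_]; lra.
Qed.

Lemma legendre_minimal (m : R) x : 0 < m -> (forall y, Om y -> 0 < u y -> m <= speed u y) ->
  Om x -> 0 < u x -> speed u x = m -> G x = -1.
Proof.
move=> m0 minf Omx ux0 xm; apply/eqP; rewrite -subr_eq0 -normr_le0 opprK.
apply/ler_addgt0Pr => eps eps0; rewrite add0r; pose h := eps / 3.
have h0 : 0 < h by rewrite divr_gt0.
have ux1 := potential_lt1 Omx.
have [t1 /andP[t10 t11] near_pole] := level_near_pole (mulr_gt0 h0 d0).
pose t := Num.max t1 (Num.max (1 - h) ((1 + u x) / 2)).
have tt1 : t1 <= t by rewrite le_max lexx.
have th : 1 - h <= t by rewrite !le_max lexx orbT.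
have tx : u x < t by rewrite !lt_max; apply/orP; right; apply/orP; right; lra.
have t_lt1 : t < 1 by rewrite !gt_max t11/=; lra.
have [||z [Omz uz Gzx]] := legendre_near_constant m0 minf Omx ux0 xm (t := t) (e := h ^+ 2).
  by rewrite tx.
  by rewrite exprn_gt0.
have {}Gzx : `|G z - G x| <= h.
  by rewrite -(@ler_pXn2r _ 2%N) ?nnegrE ?(ltW h0)// real_normK ?num_real.
have Pz : `|dot (grad u z) (z - x0)| <= h.
  apply: le_trans (norm_dot_le_enorm _ _) _.
  have -> : h = d^-1 * (h * d) by rewrite mulrCA mulVf ?mulr1// gt_eqF.
  apply: ler_pM; rewrite ?enorm_ge0// ?enorm_grad_potential_le// ltW//.
  by apply: near_pole; rewrite // uz.
move: Gzx Pz; rewrite /legendre uz !ler_norml => /andP[+ +] /andP[+ +].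
have -> : eps = h + h + h by rewrite /h; field.
by move: th t_lt1; move: (t) (dot _ _) (dot _ _) (h) => *; apply/andP; split; lra.
Qed.

Lemma legendre_potential x : Om x -> 0 < u x -> G x = -1.
Proof.
have [m [m0 minf on_level]] := exists_min_speed.
move=> Omx ux0; apply: (legendre_minimal m0 minf) => //.
apply/eqP; rewrite eq_le minf// andbT speed_enorm -[leRHS](sqr_sqrtr (ltW m0)).
rewrite ler_pXn2r ?nnegrE ?sqrtr_ge0 ?enorm_ge0//.
apply: le_trans (enorm_grad_potential_le Omx) _; apply/ler_addgt0Pr => eps eps0.
have [r0 r00 blowup] := potential_blowup n2 eps0.
have [t t01 near_pole] := level_near_pole r00; have [z [Omz uz zm]] := on_level t t01.
have z0 := Om_dist_gt0 Omz; have uz0 : 0 < u z by rewrite uz; case/andP: t01.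
have := legendre_minimal m0 minf Omz uz0 zm; rewrite /legendre => Gz.
have grad_z : 1 - u z <= Num.sqrt m * enorm (z - x0).
  have -> : Num.sqrt m = enorm (- grad u z) by rewrite enormN enormE -zm.
  by apply: le_trans (dot_le_enorm _ _); rewrite dotNl; lra.
have /blowup/le_trans/(_ grad_z) : 0 < enorm (z - x0) < r0 by rewrite z0 near_pole// uz.
by rewrite ler_pM2r// lerBlDr.
Qed.

Let ball_potential_gt0 x : 0 < enorm (x - x0) < d -> 0 < u x.
Proof.
move=> xd; have [Ox _] := ball_Om xd; apply: lt_le_trans (potential_ge_cone Ox).
by rewrite subr_gt0 ltr_pdivrMl// mulr1; case/andP: xd.
Qed.

Lemma has_grad_pole_quotient x : Om x -> 0 < u x -> exists2 g,
  has_grad (fun y => (1 - u y) * (enorm (y - x0))^-1) x g & dot g (x - x0) = 0.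
Proof.
move=> Omx ux0; have [_ xx0] := Omx; have r0 := Om_dist_gt0 Omx.
eexists.
  exact: has_gradM (has_gradB (has_grad_cst 1 x) (Du Omx)) (has_grad_inv_enorm xx0).
rewrite sub0r dotDl !dotZl !dotNl dotZl -sqr_enorm.
have := legendre_potential Omx ux0; rewrite /legendre.
have [r rE] : exists r, r = enorm (x - x0) by eexists.
rewrite -rE in r0 *; move: (dot _ _) (u x) => W v WE; have -> : W = v - 1 by lra.
by field; rewrite gt_eqF.
Qed.

(* By [legendre = -1], [(1 - u) / |x - x0|] is constant along rays. *)
Lemma potential_affine_on_ray x s : 0 < enorm (x - x0) < d -> 0 < s <= 1 ->
  1 - u (x0 + s *: (x - x0)) = s * (1 - u x).
Proof.
move=> /andP[x_gt0 xd] /andP[s0 s1].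
pose q y := (1 - u y) * (enorm (y - x0))^-1; set v := x - x0.
have ray_ball (t : R) : 0 < t <= 1 -> 0 < enorm (x0 + t *: v - x0) < d.
  move=> /andP[t0 t1]; rewrite enorm_ray ?(ltW t0)// mulr_gt0//=.
  by rewrite (le_lt_trans _ xd)// ler_piMl// ltW.
have dq (t : R) : 0 < t <= 1 -> is_derive (x0 + t *: v) v q 0.
  move=> t01; have /andP[t0 _] := t01.
  have [g /(has_grad_is_derive v) + gv] := has_grad_pole_quotient
    (ball_Om (ray_ball t t01)) (ball_potential_gt0 (ray_ball t t01)).
  move: gv; rewrite addrAC subrr add0r dotZr => /eqP.
  by rewrite mulf_eq0 gt_eqF//= => /eqP ->.
have shift_ray (t : R) : x0 + s *: v + (t * (1 - s)) *: v = x0 + (s + t * (1 - s)) *: v.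
  by rewrite -addrA -scalerDl.
have sub_ray (t : R) : 0 <= t <= 1 -> 0 < s + t * (1 - s) <= 1.
  move=> /andP[t0 t1]; have t1s : t * (1 - s) <= 1 - s by rewrite ler_piMl// subr_ge0.
  by rewrite ltr_wpDr ?mulr_ge0 ?subr_ge0//=; lra.
have [t t01|t /andP[t0 t1]] := @MVT_line _ _ q (x0 + s *: v) v (1 - s).
  by rewrite shift_ray; case: (dq _ (sub_ray t t01)).
have t01 : 0 <= t <= 1 by rewrite !ltW.
rewrite shift_ray (@derive_val _ _ _ _ _ _ _ (dq _ (sub_ray t t01))) mulr0.
rewrite -addrA -scalerDl addrCA subrr addr0 scale1r /v subrKC => /eqP; rewrite subr_eq0 => /eqP.
rewrite /q enorm_ray ?(ltW s0)// => qE.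
apply: (mulIf (_ : (s * enorm (x - x0))^-1 != 0)); first by rewrite invr_eq0 gt_eqF// mulr_gt0.
by rewrite -qE; field; rewrite !gt_eqF.
Qed.

Lemma C2_potential_eq_cone x : 0 < enorm (x - x0) < d -> u x = 1 - d^-1 * enorm (x - x0).
Proof.
move=> xd; have [Ox xx0] := ball_Om xd; apply/eqP; rewrite eq_le (potential_ge_cone Ox) andbT.
have affine_le s : 0 < s <= 1 -> 1 - u (x0 + s *: (x - x0)) <= s * (1 - u x).
  by move=> s01; rewrite potential_affine_on_ray.
by have := potential_le_cone_on_ray n2 xx0 affine_le; lra.
Qed.

Lemma C2_potential_sphere y : O y -> enorm (y - x0) = d -> u y = 0.
Proof.
move=> Oy yd; apply/eqP; rewrite eq_le potential_ge0// andbT.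
apply/ler_addgt0Pr => e e0; rewrite add0r; pose s := Num.min (e / 2) (2^-1 : R).
have s0 : 0 < s by rewrite lt_min divr_gt0//=; lra.
have se : s <= e / 2 by rewrite ge_min lexx.
have s1 : s <= 2^-1 by rewrite ge_min lexx orbT.
pose w := x0 + (1 - s) *: (y - x0).
have wE : enorm (w - x0) = (1 - s) * d by rewrite enorm_ray ?yd//; lra.
have wd : 0 < enorm (w - x0) < d by rewrite wE mulr_gt0 ?gtr_pMl//; lra.
have := potential_lipschitz (proj1 (ball_Om wd)) Oy; rewrite (C2_potential_eq_cone wd) wE.
have -> : y - w = s *: (y - x0) by apply/rowP => j; rewrite !mxE; ring.
by rewrite enormZ yd gtr0_norm// mulrCA mulVf ?gt_eqF// mulrCA mulVf ?gt_eqF//; lra.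
Qed.

Lemma C2_potential_ball : O = eball x0 d.
Proof.
apply/seteqP; split => [x Ox|x]; last exact: ball_sub.
rewrite /eball/= ltNge; apply/negP => dx.
have r0 : 0 < enorm (x - x0) := lt_le_trans d0 dx.
pose y := x0 + (d / enorm (x - x0)) *: (x - x0).
have dr0 : 0 <= d / enorm (x - x0) by rewrite divr_ge0 ?enorm_ge0.
have Oy : O y.
  apply: (segment_sub_convex convO Ox0 Ox); exists (d / enorm (x - x0)) => //.
  by rewrite /= in_itv/= dr0 ler_pdivrMr// mul1r.
have yd : enorm (y - x0) = d by rewrite enorm_ray// divfK// gt_eqF.
have Omy : Om y.
  by split => // yx0; have := d0; rewrite -yd yx0 subrr enorm0 ltxx.
apply: (grad_neq0 Omy); apply: has_grad_local_min (Du Omy).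
apply: filterS (Om_near Omy) => v [Ov _].
by rewrite (C2_potential_sphere Oy yd) potential_ge0.
Qed.

End C2Rigidity.

Lemma concave_potential_ball : (2 <= n)%N -> concave_on O u -> O = eball x0 d.
Proof.
move=> n2 u_concave.
have le_d x : O x -> enorm (x - x0) <= d.
  move=> Ox; have [->|/eqP xx0] := eqVneq x x0.
    by rewrite subrr enorm0 ltW// inradius_gt0.
  have ray (s : R) : 0 < s <= 1 -> 1 - u (x0 + s *: (x - x0)) <= s * (1 - u x).
    move=> /andP[s0 s1]; have := u_concave x0 x s Ox0 Ox.
    rewrite (ltW s0) s1 potential_pole => /(_ isT).
    have -> : (1 - s) *: x0 + s *: x = x0 + s *: (x - x0).
      by apply/rowP => j; rewrite !mxE; ring.
    by lra.
  have := potential_le_cone_on_ray n2 xx0 ray; have := potential_ge0 Ox => u0 cone.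
  have : d^-1 * enorm (x - x0) <= 1 by lra.
  by rewrite ler_pdivrMl ?inradius_gt0// mulr1.
apply/seteqP; split=> x; last exact: ball_sub.
exact: open_sub_eball oO inradius_gt0 le_d x.
Qed.

End Inradius.

Section Ball.
Variable r : R.
Hypotheses (r0 : 0 < r) (O_ball : O = eball x0 r).

Lemma ball_potential y : O y -> u y = 1 - r^-1 * enorm (y - x0).
Proof.
move=> Oy; have at_pole c : 1 + c * enorm (x0 - x0) = 1 by rewrite subrr enorm0 mulr0 addr0.
rewrite -mulNr; apply/eqP; rewrite eq_le; apply/andP; split.
  apply: potential_le; rewrite ?at_pole// => z [cz _].
  rewrite mulNr subr_ge0 ler_pdivrMl// mulr1; apply: closure_enorm_le cz => v.
  by rewrite O_ball => /ltW.
apply: potential_ge; rewrite ?at_pole// => z [_ nOz].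
rewrite mulNr subr_le0 ler_pdivlMl// mulr1 leNgt.
by apply/negP => zr; apply: nOz; rewrite O_ball.
Qed.

Lemma ball_potential_C2 : C2_on (O `\ x0) u.
Proof.
have [C2 _] := bent_cone_C2 x0 1 (- r^-1) 0.
apply: (eq_C2_on _ _ _ _ C2); first exact: open_neq_row.
- exact: open_punctured.
- by move=> y [].
- by move=> y [Oy _]; rewrite ball_potential// /bent_cone mul0r subr0 mulNr.
Qed.

Lemma ball_potential_concave : Defs.convex_set O -> concave_on O u.
Proof.
move=> convO x y t Ox Oy t01; have /andP[t0 t1] := t01; have Ow := convO x y t Ox Oy t01.
set w := (1 - t) *: x + t *: y in Ow *.
have wle : enorm (w - x0) <= (1 - t) * enorm (x - x0) + t * enorm (y - x0).
  have -> : w - x0 = (1 - t) *: (x - x0) + t *: (y - x0).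
    by apply/rowP => j; rewrite !mxE; ring.
  by apply: le_trans (ler_enormD _ _) _; rewrite !enormZ !ger0_norm ?subr_ge0.
have := ler_wpM2l (_ : 0 <= r^-1) wle; rewrite invr_ge0 (ltW r0) => /(_ isT).
by rewrite !ball_potential//; lra.
Qed.

End Ball.

End Potential.
Unset Implicit Arguments.

Theorem theorem1p4 (R : realType) (n : nat) (O : set 'rV[R]_n) (x0 : 'rV[R]_n)
  (u : 'rV[R]_n -> R) :
  (2 <= n)%N ->
  bounded_convex_domain O -> O x0 ->
  inf_harmonic_potential O x0 u ->
  ((exists r : R, 0 < r /\ O = eball x0 r) <-> C2_on (O `\ x0) u) /\
  (C2_on (O `\ x0) u <-> concave_on O u).
Proof.
move=> n2 [oO _ bO convO] Ox0 hu.
have [ys ys_nearest] := exists_nearest_frontier_point (ltnW n2) oO bO Ox0.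
have d0 := inradius_gt0 Ox0 ys_nearest.
have ball_C2 : (exists r : R, 0 < r /\ O = eball x0 r) -> C2_on (O `\ x0) u.
  by move=> [r [r0 O_ball]]; exact: ball_potential_C2 r0 O_ball.
have ball_concave : (exists r : R, 0 < r /\ O = eball x0 r) -> concave_on O u.
  by move=> [r [r0 O_ball]]; exact: ball_potential_concave r0 O_ball convO.
have C2_ball : C2_on (O `\ x0) u -> exists r : R, 0 < r /\ O = eball x0 r.
  by move=> u2; exists (enorm (ys - x0)); split => //; exact: C2_potential_ball u2.
have concave_ball : concave_on O u -> exists r : R, 0 < r /\ O = eball x0 r.
  move=> u_concave; exists (enorm (ys - x0)); split => //.
  exact: concave_potential_ball u_concave.
by split; split; auto.
Qed.
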